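(* Let $p\geq 7$ be a Mersenne prime and let $k\geq 2$ be an integer. Then there exists a finite transitive permutation group $X$ of degree $p^{3k-4}(p+1)/2$ which is elusive and has the following structure: $X$ has a normal subgroup $N$ with $X/N\cong \mathrm{PSL}_2(p)$ such that $X$ does not split over $N$ (i.e. $N$ has no complement in $X$), and $N$ has a chain of subgroups $N=N_1> N_2>\cdots> N_{k}=1$, each normal in $X$, with $N_\ell/N_{\ell+1}\cong \mathrm{C}_p^3$ for every $\ell\in\{1,\ldots,k-1\}$; moreover the point stabilizer of $X$ is isomorphic to a semidirect product $\mathrm{C}_p^2{:}\mathrm{D}_{p-1}$.
   Context: All permutation groups act on finite sets. A derangement is a permutation with no fixed points. A transitive permutation group is elusive if it contains no derangements of prime order. A Mersenne prime is a prime of the form $2^m-1$. $\mathrm{C}_n$ denotes the cyclic group of order $n$, $\mathrm{D}_{n}$ the dihedral group of order $n$, and $A{:}B$ a semidirect product of a normal subgroup $A$ by $B$. *)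

(* Defs.v *)
From mathcomp Require Import all_boot all_order all_algebra all_fingroup all_solvable.
Set Implicit Arguments. Unset Strict Implicit. Unset Printing Implicit Defensive.
Local Open Scope group_scope.

Definition mersenne_prime (p : nat) : Prop := prime p /\ exists m : nat, p = (2 ^ m - 1)%N.

Definition SL2 (p : nat) : {set {'GL_2['F_p]}} :=
  [set g : {'GL_2['F_p]} | (\det (GLval g) == 1)%R].
Definition scalar_SL2 (p : nat) : {set {'GL_2['F_p]}} :=
  [set g in SL2 p | is_scalar_mx (GLval g)].
Definition PSL2 (p : nat) := (SL2 p / scalar_SL2 p)%g.

(* C_p^n realised as the additive group of row vectors F_p^n. *)
Definition elemC (p n : nat) := [set: 'rV['F_p]_n].

Definition derangement (T : finType) (x : {perm T}) : bool := [forall i, x i != i].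
Definition elusive (T : finType) (X : {group {perm T}}) : Prop :=
  [transitive X, on [set: T] | 'P] /\
  forall x, x \in X -> prime #[x] -> ~~ derangement x.

(* Main.v *)
(* Take X to be the image of SL_2(Z/p^k) in the permutations of the cosets of
   the subgroup H generated by the matrices 1 + p^(k-1) A with A of zero diagonal,
   by a diagonal matrix of order (p - 1)/2 and by [[0, -1], [1, 0]]; the core of H
   is {1, -1}, so that X = PSL_2(Z/p^k). The normal chain consists of the
   congruence subgroups {1 + p^l A}.

   The degree is p^(3k-4) 2^(m-1), where p = 2^m - 1. An element of prime order
   r different from 2 and p has a fixed point because r does not divide the
   degree. Involutions lift to elements g with g^2 = -1, all of which are
   conjugate to [[0, -1], [1, 0]] in H. Finally, since p > 3, every element of
   order p lies in the last congruence subgroup 1 + p^(k-1) sl_2(p), and a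
   traceless 2 x 2 matrix is conjugate to one of zero diagonal. The same
   description of the elements of order p forbids a complement to N. *)
From HB Require Import structures.
Require Import Defs.
From mathcomp Require Import all_boot all_order all_algebra all_fingroup all_solvable all_field all_character.
From mathcomp Require Import ring zify.
Set Implicit Arguments. Unset Strict Implicit. Unset Printing Implicit Defensive.
Import GRing.Theory.
Local Open Scope group_scope.

(** * Permutation representations, quotients of images and fixed points *)

(** The action on right cosets is transported along their enumeration, so that the permutations act
    on ['I_d] itself; [i0] is the number of the coset [H]. *)
Lemma coset_representation (gT : finGroupType) (G H : {group gT}) d :
    H \subset G -> #|G : H| = d ->
  exists (f : {morphism G >-> {perm 'I_d}}) (i0 : 'I_d),
    [/\ 'ker f = gcore H G, [transitive f @* G, on [set: 'I_d] | 'P]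
      & 'C_(f @* G)[i0 | 'P] = f @* H].
Proof.
move=> sHG <- {d}; set S := rcosets H G.
have HS : H :* 1 \in S by apply/rcosetsP; exists 1; rewrite ?group1.
have actS x g : x \in S -> g \in G -> 'Rs%act x g \in S.
  by move=> xS gG; rewrite (actsP (atrans_acts (transRs_rcosets H G))).
pose e (i : 'I_#|S|) : {set gT} := enum_val i.
have eS i : e i \in S by exact: enum_valP.
(* [is_action] asks for injectivity at every [g], also outside [G], where [to] is therefore the
   identity. *)
pose to (i : 'I_#|S|) g := if g \in G then enum_rank_in HS ('Rs%act (e i) g) else i.
have toE i g : g \in G -> e (to i g) = 'Rs%act (e i) g.
  by move=> gG; rewrite /to gG /e enum_rankK_in ?actS.
have to_act : is_action G to.
  split=> [g i j|i g h gG hG].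
    have [gG E|gG] := boolP (g \in G); last by rewrite /to (negPf gG).
    apply/enum_val_inj/(act_inj 'Rs g).
    by rewrite -[LHS](toE i g gG) -[RHS](toE j g gG) E.
  by apply: enum_val_inj; rewrite -!/(e _) !toE ?groupM // actMin.
pose A := Action to_act.
pose f := actperm_morphism A.
have fE g i : f g i = to i g by rewrite actpermE.
pose i0 := enum_rank_in HS (H :* 1).
have e0 : e i0 = H by rewrite /e enum_rankK_in // rcoset1.
have f0 g : g \in G -> e (f g i0) = H :* g by move=> gG; rewrite fE toE // e0 /= rcosetE.
exists f, i0; split.
- rewrite -astabRs_rcosets; apply/setP=> g; apply/idP/idP => [gK|gC].
    have gG := dom_ker gK; apply/astabP=> x xS.
    rewrite -(enum_rankK_in HS xS) -[LHS](toE _ _ gG) -fE.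
    by rewrite (mker gK) perm1.
  have gG : g \in G.
    by move: gC; rewrite astabRs_rcosets => /(subsetP (gcore_sub _ _)); apply: (subsetP sHG).
  apply/kerP => //; apply/permP=> i; apply: enum_val_inj.
  by rewrite -!/(e _) perm1 fE toE // (astabP gC) // eS.
- apply/imsetP; exists i0 => //; apply/setP=> i; rewrite inE; symmetry; apply/orbitP.
  have /rcosetsP[x xG ix] := eS i.
  exists (f x); first exact: mem_morphim.
  by apply: enum_val_inj; rewrite -!/(e _) ix -f0.
apply/setP=> y; apply/setIP/morphimP => [[/morphimP[g gG _ ->] /astab1P E]|[g gG gH ->]].
  exists g => //; have := f0 g gG; rewrite -[f g i0]/('P%act i0 (f g)) E e0 => ->.
  exact: rcoset_refl.
split; first exact: mem_morphim.
apply/astab1P/enum_val_inj; rewrite -!/(e _) -[LHS]/(e (f g i0)) f0 // e0.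
exact: rcoset_id.
Qed.

Lemma isog_elemC (gT : finGroupType) (A : {group gT}) p n :
  prime p -> p.-abelem A -> #|A| = (p ^ n)%N -> A \isog elemC p n.
Proof.
move=> pr_p abA cA; rewrite (isog_abelem_card _ abA) mx_Fp_abelem //=.
by rewrite cardsT card_mx card_Fp // mul1n cA.
Qed.

Lemma isog_dihedral_gen (gT : finGroupType) (G : {group gT}) (x y : gT) n :
    G :=: <<[set x; y]>> -> #[x] = 2%N -> #[y] = 2%N -> x != y -> #|G| = n ->
  G \isog 'D_n.
Proof.
by move=> -> ox oy neq <-; apply: involutions_gen_dihedral.
Qed.

(** [f] followed by the quotient map by [f @* B] has kernel [B] on [A], because ['ker_A f] lies in
    [B]; the first isomorphism theorem applies. *)
Lemma morphim_quotient_isog (aT rT : finGroupType) (D A B : {group aT})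
    (f : {morphism D >-> rT}) :
    A \subset D -> B <| A -> 'ker_A f \subset B ->
  A / B \isog f @* A / f @* B.
Proof.
move=> sAD nsBA kB; have [sBA nBA] := andP nsBA.
pose h := coset_morphism (f @* B) \o f.
have sAh : A \subset f @*^-1 'N(f @* B).
  by rewrite -sub_morphim_pre // morphim_norms.
have := first_isog_loc [morphism of h] sAh.
rewrite /= morphim_comp -quotientE.
suff -> : 'ker_A h = B by [].
rewrite ker_comp ker_coset morphimK ?(subset_trans sBA) //.
by rewrite -group_modr //; apply: mulSGid.
Qed.

Lemma fixed_point_of_conj (T : finType) (x y : {perm T}) i :
  x ^ y \in 'C[i | 'P] -> exists j, x j = j.
Proof.
move/astab1P; rewrite /= /aperm conjgE !permM => E; exists (y^-1 i).
by apply: (@perm_inj _ y); rewrite E permKV.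
Qed.

(** If x has prime order r, the orbits of [<[x]>] have length 1 or r, so the number of fixed points
    is congruent to the degree modulo r. *)
Lemma fixed_point_coprime (T : finType) (x : {perm T}) :
  prime #[x] -> ~~ (#[x] %| #|T|)%N -> exists j, x j = j.
Proof.
move=> pr_x ndv.
have xgrp : #[x].-group <[x]> by apply: pnat_id.
have acts : [acts <[x]>, on [set: T] | 'P] by apply/actsP=> a _ i; rewrite !inE.
have := pgroup_fix_mod xgrp acts; rewrite cardsT => E.
have /card_gt0P[j] : (0 < #|'Fix_([set: T] | 'P)(<[x]>)|)%N.
  rewrite lt0n; apply: contra ndv => /eqP F0.
  by rewrite /dvdn E F0 mod0n.
rewrite setTI afix_cycle => /afix1P jx; exists j; exact: jx.
Qed.

Local Open Scope ring_scope.

(** * Two by two matrices *)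

Definition mx2 (R : Type) (a b c d : R) : 'M[R]_2 :=
  \matrix_(i, j) if i == 0 then if j == 0 then a else b
                 else if j == 0 then c else d.

Lemma mx2_eta (R : Type) (A : 'M[R]_2) : A = mx2 (A 0 0) (A 0 1) (A 1 0) (A 1 1).
Proof.
apply/matrixP=> -[[|[|//]] ?] -[[|[|//]] ?]; rewrite mxE /=; congr (A _ _); exact: val_inj.
Qed.

Lemma mx2P (R : Type) (a b c d a' b' c' d' : R) :
  mx2 a b c d = mx2 a' b' c' d' -> [/\ a = a', b = b', c = c' & d = d'].
Proof.
move/matrixP=> E; move: (E 0 0) (E 0 1) (E 1 0) (E 1 1).
by rewrite !mxE /= => -> -> -> ->.
Qed.

Lemma map_mx2 (R S : Type) (f : R -> S) a b c d :
  map_mx f (mx2 a b c d) = mx2 (f a) (f b) (f c) (f d).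
Proof. by rewrite (mx2_eta (map_mx _ _)) !mxE. Qed.

Section Matrix2.
Variable R : comNzRingType.
Implicit Types (a b c d : R).

Lemma add_mx2 a b c d a' b' c' d' :
  mx2 a b c d + mx2 a' b' c' d' = mx2 (a + a') (b + b') (c + c') (d + d').
Proof. by rewrite (mx2_eta (_ + _)) !mxE. Qed.

Lemma scale_mx2 x a b c d : x *: mx2 a b c d = mx2 (x * a) (x * b) (x * c) (x * d).
Proof. by rewrite (mx2_eta (_ *: _)) !mxE. Qed.

Lemma opp_mx2 a b c d : - mx2 a b c d = mx2 (- a) (- b) (- c) (- d).
Proof. by rewrite (mx2_eta (- _)) !mxE. Qed.

Lemma scalar_mx2 a : a%:M = mx2 a 0 0 a.
Proof. by rewrite (mx2_eta _%:M) !mxE /= ?mulr1n ?mulr0n. Qed.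

Lemma one_mx2 : 1 = mx2 1 0 0 1 :> 'M[R]_2.
Proof. exact: scalar_mx2. Qed.

Lemma mul_mx2 a b c d a' b' c' d' :
  mx2 a b c d * mx2 a' b' c' d' =
  mx2 (a * a' + b * c') (a * b' + b * d') (c * a' + d * c') (c * b' + d * d').
Proof.
rewrite (mx2_eta (_ * _)) -mulmxE !mxE !big_ord_recl !big_ord0 !mxE /= !addr0.
by [].
Qed.

Lemma det_mx2 a b c d : \det (mx2 a b c d) = a * d - b * c.
Proof.
rewrite (expand_det_row _ 0) !big_ord_recl big_ord0 /cofactor !det_mx11 !mxE /=.
by rewrite /bump /=; ring.
Qed.

(** Cayley-Hamilton, with constant term 1. *)
Lemma mx2_sqrE (g : 'M[R]_2) : \det g = 1 -> g ^+ 2 = \tr g *: g - 1.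
Proof.
rewrite (mx2_eta g) det_mx2 /mxtrace !big_ord_recl big_ord0 !mxE /= => dg.
rewrite expr2 mul_mx2 scale_mx2 one_mx2 opp_mx2 add_mx2 -dg.
by congr mx2; ring.
Qed.

End Matrix2.

(** The middle binomial coefficients are divisible by p; [y] collects the quotients in degrees 2 to
    p - 1 and, being a polynomial in [B], commutes with it. *)
Lemma exprD1_prime (S : nzRingType) (B : S) p : prime p -> (2 < p)%N ->
  exists y, [/\ GRing.comm B y & (B + 1) ^+ p = 1 + p%:R * B * (1 + B * y) + B ^+ p].
Proof.
case: p => [|[|[|n]]] // pr _.
exists (\sum_(i < n.+1) B ^+ i *+ ('C(n.+3, i.+2) %/ n.+3)%N); split.
  by apply: commr_sum => i _; apply/commrMn/commrX.
rewrite addrC exprDn_comm; last exact/commr_sym/commr1.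
under eq_bigr => i _ do rewrite expr1n mul1r.
rewrite big_ord_recr big_ord_recl big_ord_recl /= expr0 expr1 bin0 binn bin1 !mulr1n.
congr (_ + _); congr (_ + _).
rewrite mulrDr mulr1 mulr_natl mulrnAl; congr (_ + _).
rewrite mulrA -expr2 mulr_sumr -sumrMnl; apply: eq_bigr => i _.
rewrite /= /bump /= !add1n mulrnAr -exprD add2n -mulrnA.
have dv : (n.+3 %| 'C(n.+3, i.+2))%N by apply: prime_dvd_bin => //=; have := ltn_ord i; lia.
by rewrite divnK.
Qed.

(** * The ring of integers modulo p^k *)

(* Z/p^k with its reduction modulo p, kept abstract so that unification never
   unfolds the arithmetic of 'Z_(p ^ k). *)
Record chain_ring (p k : nat) (R : finComUnitRingType) (red : {rmorphism R -> 'F_p}) : Prop :=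
  ChainRing {
    chain_prime : prime p;
    chain_ker : forall x, red x = 0 <-> exists y, x = p%:R * y;
    chain_unit : forall x : R, red x != 0 -> x \is a GRing.unit;
    chain_pexp : p%:R ^+ k = 0 :> R;
    chain_ann : forall x, p%:R ^+ k.-1 * x = 0 -> red x = 0;
    chain_euler : forall x : R, x \is a GRing.unit -> x ^+ (p ^ k.-1 * p.-1) = 1 }.

Section ChainRing.
Variables (p k o : nat) (R : finComUnitRingType) (red : {rmorphism R -> 'F_p}).
Hypothesis chR : chain_ring k red.

Implicit Types x y : R.
Let pr_p : prime p := chain_prime chR.

Lemma red_lift (a : 'F_p) : exists x, red x = a.
Proof. by exists ((a : nat)%:R); rewrite rmorph_nat natr_Zp. Qed.

Lemma red_p : red p%:R = 0.
Proof. by apply/(chain_ker chR); exists 1; rewrite mulr1. Qed.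

Lemma unit_redE x : (x \is a GRing.unit) = (red x != 0).
Proof.
apply/idP/idP; last exact: (chain_unit chR).
by move=> ux; rewrite -unitfE rmorph_unit.
Qed.

(** Multiplying by p^(k-1-l) kills the right-hand side, since p^k = 0, and leaves an instance of
    [chain_ann]. *)
Lemma pmul_cancel l x y : (l < k)%N -> p%:R ^+ l * x = p%:R ^+ l.+1 * y -> red x = 0.
Proof.
move=> ltlk E; apply: (chain_ann chR).
have -> : k.-1 = (k.-1 - l + l)%N by lia.
rewrite exprD -mulrA E mulrA -exprD.
have -> : (k.-1 - l + l.+1)%N = k by lia.
by rewrite (chain_pexp chR) mul0r.
Qed.

Lemma pmul_eq0 x : p%:R * x = 0 -> exists y, x = p%:R ^+ k.-1 * y.
Proof.
move=> px0.
(* Factors p are split off one at a time: below exponent [k.-1], [pmul_cancel] shows that the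
   cofactor is again divisible by p. *)
suff H j : (j <= k.-1)%N -> exists y, x = p%:R ^+ j * y by exact: H.
elim: j => [|j IHj] ltj; first by exists x; rewrite mul1r.
have [y xE] := IHj (ltnW ltj).
have /(chain_ker chR)[z yE] : red y = 0.
  apply: (@pmul_cancel j.+1 _ 0); first by lia.
  by rewrite mulr0 exprS -mulrA -xE.
by exists z; rewrite exprSr -mulrA -yE.
Qed.

Hypotheses (pE : p = o.*2.+1) (odd_o : odd o).

Let odd_p : odd p. Proof. by rewrite pE /= odd_double. Qed.

Lemma red2_neq0 : (2%:R : 'F_p) != 0.
Proof.
rewrite -(dvdn_pcharf (pchar_Fp pr_p)) dvdn_prime2 // pE.
by apply/eqP; lia.
Qed.

(** x - 1 and x + 1 differ by the unit 2, so one of them is a unit, and then the other vanishes. *)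
Lemma sqr_eq1 (x : R) : x ^+ 2 = 1 -> x = 1 \/ x = -1.
Proof.
move=> x2.
have E : (x - 1) * (x + 1) = 0 by rewrite -subr_sqr x2 expr1n subrr.
have [r0|u] := eqVneq (red (x + 1)) 0; last first.
  by left; apply/eqP; rewrite -subr_eq0 -(mulIr_eq0 _ (mulIr (chain_unit chR u))) E.
right; apply/eqP; rewrite -addr_eq0 -(mulrI_eq0 _ (mulrI (chain_unit chR (x := x - 1) _))) ?E //.
have -> : x - 1 = x + 1 - 2%:R by ring.
by rewrite rmorphB r0 sub0r oppr_eq0 rmorph_nat red2_neq0.
Qed.

(** Let n = p^(k-1) o, half the exponent in [chain_euler]. Then x^n is 1 or -1, and since n is odd,
    x x^n is the square of x^((n+1)/2). *)
Lemma unit_sqrPN x : x \is a GRing.unit ->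
  exists2 s, s \is a GRing.unit & x = s ^+ 2 \/ x = - s ^+ 2.
Proof.
move=> ux; pose n := (p ^ k.-1 * o)%N.
have odd_n : odd n by rewrite oddM oddX odd_o odd_p orbT.
exists (x ^+ n.+1./2); first exact: unitrX.
have -> : (x ^+ n.+1./2) ^+ 2 = x * x ^+ n.
  by rewrite -exprM -exprS; congr (_ ^+ _); lia.
have [] : x ^+ n = 1 \/ x ^+ n = -1.
- apply: sqr_eq1; rewrite -exprM -(chain_euler chR ux); congr (_ ^+ _).
  by rewrite /n -mulnA; congr (_ * _)%N; lia.
- by move=> ->; left; rewrite mulr1.
by move=> ->; right; rewrite mulrN1 opprK.
Qed.

(** For the odd number n = p^(k-1) o, [chain_euler] gives a^(2n) = 1, whereas (-1)^n = -1. Here p =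
    3 modulo 4 enters. *)
Lemma red_sqr_neqN1 (a : 'F_p) : a ^+ 2 != -1.
Proof.
apply/eqP=> a2; have [x ax] := red_lift a.
have ux : x \is a GRing.unit.
  rewrite unit_redE ax; apply/eqP=> a0; move/eqP: a2.
  by rewrite a0 expr0n /= eq_sym oppr_eq0 oner_eq0.
have := congr1 red (chain_euler chR ux).
rewrite rmorphXn rmorph1 ax.
have -> : (p ^ k.-1 * p.-1 = 2 * (p ^ k.-1 * o))%N by lia.
rewrite exprM a2 -signr_odd oddM oddX odd_o odd_p orbT /= => /eqP.
by rewrite eq_sym -addr_eq0 -mulr2n (negPf red2_neq0).
Qed.

(* If n is the largest integer such that 1, ..., n are unit squares, then
   n = t^2 and n + 1 = - s^2, whence (t / s)^2 + (1 / s)^2 = -1. *)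
Lemma sum2sqr_N1 : exists a b : R, a ^+ 2 + b ^+ 2 = -1.
Proof.
pose sq n := [exists s : R, (s \is a GRing.unit) && (n.+1%:R == s ^+ 2)].
have [n nsq minn] : exists2 n, ~~ sq n & forall m, (m < n)%N -> sq m.
  have exn : exists n, ~~ sq n.
    (* [sq n] speaks of n + 1, so [p.-2] stands for p - 1 = -1, which is not a square modulo p. *)
    exists p.-2; apply/existsPn=> s; apply/negP=> /andP[_ /eqP/(congr1 red)].
    have -> : p.-2.+1 = p.-1 by lia.
    rewrite rmorph_nat rmorphXn => E; have := red_sqr_neqN1 (red s).
    rewrite -E -addr_eq0 natr1 prednK ?prime_gt0 //.
    by rewrite pchar_Fp_0 ?eqxx.
  exists (ex_minn exn); first by case: ex_minnP.
  by move=> m; case: ex_minnP => n _ minn; apply: contraLR => /minn; rewrite -leqNgt.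
case: n => [|n] in nsq minn *.
  by case/existsP: nsq; exists 1; rewrite unitr1 expr1n eqxx.
have ltnp : (n.+2 < p)%N.
  rewrite ltnNge; apply/negP => lepn.
  have : sq p.-2 by apply: minn; lia.
  case/existsP=> s /andP[_ /eqP/(congr1 red)].
  have -> : p.-2.+1 = p.-1 by lia.
  rewrite rmorph_nat rmorphXn => E; have := red_sqr_neqN1 (red s).
  rewrite -E -addr_eq0 natr1 prednK ?prime_gt0 //.
  by rewrite pchar_Fp_0 ?eqxx.
have un : n.+2%:R \is a @GRing.unit R.
  by rewrite unit_redE rmorph_nat -(dvdn_pcharf (pchar_Fp pr_p)) gtnNdvd.
have /existsP[t /andP[_ /eqP tE]] := minn n (ltnSn n).
have [s us [E|E]] := unit_sqrPN un.
  by case/existsP: nsq; exists s; rewrite us E eqxx.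
exists (t / s), (s^-1).
have : t ^+ 2 + 1 = - s ^+ 2 by rewrite -E -tE natr1.
rewrite expr_div_n exprVn => E2.
rewrite -[X in _ + X]mul1r -mulrDl E2 mulNr divrr ?unitrX //.
Qed.

(** In place of Hensel lifting, z is the power 2 p^(k-1) of any lift of a generator w of the units
    of F_p: z^o = 1 by [chain_euler], and the same power of w has order o since p is prime to o. *)
Lemma chain_root : exists z : R, z ^+ o = 1 /\ o.-primitive_root (red z).
Proof.
have [w prw] : exists w : 'F_p, (p.-1).-primitive_root w.
  pose rs := [seq x <- enum 'F_p | x != 0].
  (* The nonzero elements are p - 1 distinct roots of X^(p-1) - 1. *)
  have /hasP[w _ pw] : has (p.-1).-primitive_root rs; last by exists w.
  apply: has_prim_root; first by lia.
  - apply/allP=> x; rewrite mem_filter unity_rootE => /andP[x0 _].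
    have := expf_card x; rewrite card_Fp // => /eqP.
    have -> : x ^+ p = x * x ^+ p.-1 by rewrite -exprS prednK ?prime_gt0.
    by rewrite -{3}[x]mulr1 (inj_eq (mulfI x0)).
  - by rewrite filter_uniq ?enum_uniq.
  have -> : p.-1 = (#|{: 'F_p}| - 1)%N by rewrite card_Fp // subn1.
  rewrite size_filter cardE -(count_predC (pred1 (0 : 'F_p)) (enum _)).
  by rewrite count_uniq_mem ?enum_uniq ?mem_enum // addnC addnK.
have [x xw] := red_lift w.
have ux : x \is a GRing.unit.
  rewrite unit_redE xw; apply/eqP=> w0; have := prim_expr_order prw.
  have -> : p.-1 = (o.*2.-1).+1 by lia.
  by rewrite w0 expr0n => /eqP; rewrite eq_sym oner_eq0.
exists (x ^+ (2 * p ^ k.-1)); split.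
  rewrite -exprM -(chain_euler chR ux); congr (_ ^+ _); lia.
rewrite rmorphXn xw.
have := exp_prim_root prw (2 * p ^ k.-1).
have -> : p.-1 = (2 * o)%N by lia.
rewrite -muln_gcdr; have /eqP-> : coprime (p ^ k.-1) o.
  by apply: coprimeXl; rewrite prime_coprime // gtnNdvd; lia.
by rewrite muln1 mulKn.
Qed.

End ChainRing.

Lemma Zp_chain_ring p k : prime p -> (1 < k)%N ->
  exists red : {rmorphism 'Z_(p ^ k) -> 'F_p}, chain_ring k red.
Proof.
move=> pr_p k2; set q := (p ^ k)%N.
have p_gt1 := prime_gt1 pr_p.
have q_gt1 : (1 < q)%N by rewrite -(exp1n k) ltn_exp2r //; lia.
have qE : q = (p * p ^ k.-1)%N by rewrite -expnS prednK //; lia.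
have pk_gt0 : (0 < p ^ k.-1)%N by rewrite expn_gt0 prime_gt0.
pose f (x : 'Z_q) : 'F_p := (x : nat)%:R.
have chp := pchar_Fp pr_p.
have fn m : f m%:R = m%:R.
  rewrite /f val_Zp_nat // -(Fp_nat_mod pr_p) modn_dvdm ?Fp_nat_mod //.
  by rewrite qE dvdn_mulr.
have fD : nmod_morphism f.
  split=> [|x y]; first by rewrite -(mulr0n 1) fn.
  by rewrite -[x]natr_Zp -[y]natr_Zp -natrD !fn natrD.
have fM : monoid_morphism f.
  split=> [|x y]; first by rewrite -[1 in LHS]mulr1n fn.
  by rewrite -[x]natr_Zp -[y]natr_Zp -natrM !fn natrM.
pose red : {rmorphism 'Z_q -> 'F_p} :=
  HB.pack f (GRing.isNmodMorphism.Build _ _ f fD) (GRing.isMonoidMorphism.Build _ _ f fM).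
have redE x : red x = (x : nat)%:R by [].
have natq0 m : (m%:R == 0 :> 'Z_q) = (q %| m)%N.
  by rewrite -val_eqE /= val_Zp_nat.
exists red; split=> //.
- move=> x; split=> [/eqP|[y ->]]; last first.
    by rewrite rmorphM rmorph_nat pchar_Fp_0 // mul0r.
  rewrite redE -(dvdn_pcharf chp) => /dvdnP[m xm]; exists m%:R.
  by rewrite -[x]natr_Zp xm natrM mulrC.
- move=> x; rewrite redE -(dvdn_pcharf chp) -prime_coprime // => co.
  by rewrite -[x]natr_Zp unitZpE // coprime_pexpl //; lia.
- by apply/eqP; rewrite -natrX natq0.
- move=> x /eqP; rewrite -[x in _ * x]natr_Zp -natrX -natrM natq0 redE.
  move: (x : nat) => m; rewrite qE mulnC dvdn_pmul2l // (dvdn_pcharf chp).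
  by move/eqP.
move=> x ux; have := expg_cardG (in_setT (FinRing.unit _ ux)).
have -> : #|[set: {unit 'Z_q}]| = (p ^ k.-1 * p.-1)%N.
  by rewrite card_units_Zp ?totient_pfactor 1?mulnC //; lia.
by move/(congr1 val); rewrite FinRing.val_unitX.
Qed.

(** * Special linear groups and congruence subgroups *)

Section SpecialLinear.
Variable R : finComUnitRingType.
Implicit Types (g h : {'GL_2[R]}) (a b c d : R).

Definition SL : {set {'GL_2[R]}} := [set g : {'GL_2[R]} | \det (GLval g) == 1].

Lemma in_SL g : (g \in SL) = (\det (GLval g) == 1).
Proof. by rewrite inE. Qed.

Lemma SL_group_set : group_set SL.
Proof.
apply/group_setP; split=> [|g h]; first by rewrite in_SL GL_1E det1.
by rewrite !in_SL GL_ME det_mulmx => /eqP-> /eqP->; rewrite mulr1.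
Qed.
Canonical SL_group := group SL_group_set.

(** The default 1 of [insubd] arises only for a non-invertible matrix; [slE] excludes it when the
    determinant is 1. *)
Definition sl a b c d : {'GL_2[R]} := insubd (1%g : {'GL_2[R]}) (mx2 a b c d).

Lemma slE a b c d : a * d - b * c = 1 -> GLval (sl a b c d) = mx2 a b c d.
Proof.
by move=> d1; apply: insubdK; rewrite -topredE /= unitmxE det_mx2 d1 unitr1.
Qed.

Lemma sl_in a b c d : a * d - b * c = 1 -> sl a b c d \in SL.
Proof. by move=> d1; rewrite in_SL slE // det_mx2 d1. Qed.

Lemma SLP g : reflect
  (exists a b c d, a * d - b * c = 1 /\ GLval g = mx2 a b c d) (g \in SL).
Proof.
rewrite in_SL; apply: (iffP eqP) => [|[a [b [c [d [d1 ->]]]]]]; last by rewrite det_mx2.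
rewrite (mx2_eta (GLval g)) det_mx2 => d1.
by do 4!eexists; split; first exact: d1.
Qed.

Lemma GLval_inj : injective (@GLval 2 R). Proof. exact: val_inj. Qed.

Lemma GL_XE g n : GLval (g ^+ n)%g = GLval g ^+ n.
Proof. exact: FinRing.val_unitX. Qed.

(** The hypothesis has the form h A = g h so that a conjugate can be computed without inverting
    [h]. *)
Lemma GLval_conj g h (A : 'M[R]_2) :
  GLval h * A = GLval g * GLval h -> GLval (g ^ h)%g = A.
Proof.
move=> E; apply: (mulrI (GL_unit h)).
by rewrite -GL_ME -conjgC GL_ME E.
Qed.

Lemma GLval_conjE g h : GLval (g ^ h)%g = (GLval h)^-1 * GLval g * GLval h.
Proof. by rewrite conjgE !GL_ME GL_VE mulrA. Qed.

Definition negI : {'GL_2[R]} := sl (-1) 0 0 (-1).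

Lemma negI_E : GLval negI = -1.
Proof. by rewrite slE ?one_mx2 ?opp_mx2 ?oppr0 //; ring. Qed.

Lemma negI_in : negI \in SL. Proof. by apply: sl_in; ring. Qed.

Lemma mul_negI g : GLval (negI * g)%g = - GLval g.
Proof. by rewrite GL_ME negI_E mulN1r. Qed.

Lemma negI_comm g : commute negI g.
Proof. by apply: GLval_inj; rewrite !GL_ME negI_E mulN1r mulrN1. Qed.

Lemma negI_sqr : (negI * negI = 1)%g.
Proof. by apply: GLval_inj; rewrite mul_negI negI_E opprK. Qed.

Lemma order_negI : (2%:R : R) != 0 -> #[negI] = 2%N.
Proof.
move=> two; apply: nt_prime_order => //; first by rewrite expgS expg1 negI_sqr.
apply/eqP => /(congr1 (@GLval _ _)); rewrite negI_E GL_1E one_mx2 opp_mx2 => E.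
have [E1 _ _ _] := mx2P E; move: two.
by rewrite mulr2n -{1}E1 addNr eqxx.
Qed.

Lemma negI_center : SL \subset 'C(<[negI]>).
Proof. by rewrite centsC cycle_subG; apply/centP=> g _; exact: negI_comm. Qed.

End SpecialLinear.

Lemma scalar_SL (F : finFieldType) : (2%:R : F) != 0 ->
  [set g in SL F | is_scalar_mx (GLval g)] = <[negI F]>%g.
Proof.
move=> two; rewrite cycle2g ?order_negI //; apply/setP=> h.
rewrite inE in_SL in_set2; apply/andP/orP.
  case=> hS /is_scalar_mxP[a hE].
  have : a ^+ 2 == 1.
    by rewrite -(eqP hS) hE scalar_mx2 det_mx2; apply/eqP; ring.
  rewrite sqrf_eq1 => /orP[] /eqP aE; [left | right]; apply/eqP/GLval_inj.
    by rewrite hE aE.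
  by rewrite hE aE negI_E raddfN.
case=> /eqP->; first by rewrite GL_1E det1 eqxx scalar_mx_is_scalar.
by rewrite -in_SL negI_in negI_E -raddfN scalar_mx_is_scalar.
Qed.

Section MapGL.
Variables (R S : finComUnitRingType) (f : {rmorphism R -> S}).
Implicit Types (g h : {'GL_2[R]}).

Definition map_GL g : {'GL_2[S]} := insubd (1%g : {'GL_2[S]}) (map_mx f (GLval g)).

Lemma map_GLE g : GLval (map_GL g) = map_mx f (GLval g).
Proof.
apply: insubdK; rewrite -topredE /= unitmxE det_map_mx.
by apply: rmorph_unit; rewrite -unitmxE; have := GL_unit g.
Qed.

Lemma map_GLM g h : map_GL (g * h)%g = (map_GL g * map_GL h)%g.
Proof. by apply: GLval_inj; rewrite GL_MxE !map_GLE GL_MxE map_mxM. Qed.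

Lemma map_GL_SL g : g \in SL R -> map_GL g \in SL S.
Proof. by rewrite !in_SL map_GLE det_map_mx => /eqP->; rewrite rmorph1. Qed.

Lemma map_GL_negI : map_GL (negI R) = negI S.
Proof. by apply: GLval_inj; rewrite map_GLE !negI_E map_mxN map_mx1. Qed.

End MapGL.

(** * Reduction modulo p and the layers of the congruence filtration *)

Section Reduction.
Variables (p k : nat) (R : finComUnitRingType) (red : {rmorphism R -> 'F_p}).
Hypotheses (chR : chain_ring k red) (k2 : (1 < k)%N).
Implicit Types (g h : {'GL_2[R]}) (a b c d x y : R).

Let pr_p : prime p := chain_prime chR.

Definition red_GL := map_GL red.

Lemma red_GLE g : GLval (red_GL g) = map_mx red (GLval g).
Proof. exact: map_GLE. Qed.

Lemma red_GLM : {in SL R &, {morph red_GL : g h / (g * h)%g}}.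
Proof. by move=> g h _ _; apply: map_GLM. Qed.
Canonical red_GL_morphism := Morphism red_GLM.

(** For surjectivity, arbitrary lifts of the entries have a determinant reducing to 1, hence a unit;
    dividing the first row by it makes it 1 and leaves the reduction unchanged. *)
Lemma red_GL_im : red_GL @* SL R = SL2 p.
Proof.
apply/setP=> h; apply/morphimP/idP => [[g _ gS ->]|].
  exact: map_GL_SL.
case/(@SLP 'F_p h)=> [a' [b' [c' [d' [d1 hE]]]]].
have [a aE] := red_lift red a'; have [b bE] := red_lift red b'.
have [c cE] := red_lift red c'; have [d dE] := red_lift red d'.
have rD : red (a * d - b * c) = 1 by rewrite rmorphB !rmorphM aE bE cE dE.
have uD : a * d - b * c \is a GRing.unit by rewrite (unit_redE chR) rD oner_eq0.
have D1 : (a * d - b * c)^-1 * a * d - (a * d - b * c)^-1 * b * c = 1.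
  by rewrite -!mulrA -mulrBr mulVr.
exists (sl ((a * d - b * c)^-1 * a) ((a * d - b * c)^-1 * b) c d); try exact: sl_in.
apply: GLval_inj; rewrite red_GLE slE // map_mx2 !rmorphM rmorphV // rD invr1 !mul1r.
by rewrite aE bE cE dE.
Qed.

Definition Gamma l : {set {'GL_2[R]}} :=
  [set g in SL R | [exists A : 'M[R]_2, GLval g == 1 + p%:R ^+ l *: A]].

Lemma GammaP l g :
  reflect (g \in SL R /\ exists A : 'M[R]_2, GLval g = 1 + p%:R ^+ l *: A) (g \in Gamma l).
Proof.
apply: (iffP setIdP) => -[gS /=]; first by case/existsP=> A /eqP E; split=> //; exists A.
by case=> A E; split=> //; apply/existsP; exists A; apply/eqP.
Qed.

Lemma Gamma_group_set l : group_set (Gamma l).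
Proof.
apply/group_setP; split=> [|g h /GammaP[gS [A gE]] /GammaP[hS [B hE]]].
  by apply/GammaP; split; [exact: group1 | exists 0; rewrite scaler0 addr0].
apply/GammaP; split; first exact: groupM.
exists (A + B + p%:R ^+ l *: (A * B)).
rewrite GL_ME gE hE mulrDl mul1r mulrDr mulr1 -scalerAl -scalerAr !scalerDr -!addrA.
by congr (_ + _); rewrite addrCA.
Qed.
Canonical Gamma_group l := group (Gamma_group_set l).

Lemma Gamma_sub l : Gamma l \subset SL R.
Proof. by apply/subsetP=> g /GammaP[]. Qed.

Lemma Gamma_norm l : SL R \subset 'N(Gamma l).
Proof.
apply/subsetP=> h hS; rewrite inE; apply/subsetP=> _ /imsetP[g /GammaP[gS [A gE]] ->].
apply/GammaP; split; first exact: groupJ.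
exists ((GLval h)^-1 * A * GLval h).
by rewrite GLval_conjE gE mulrDr mulr1 mulrDl mulVr ?GL_unit // -scalerAr -scalerAl.
Qed.

Lemma Gamma_normal l : Gamma l <| SL R.
Proof. by rewrite /normal Gamma_sub Gamma_norm. Qed.

Lemma Gamma_subS l m : (l <= m)%N -> Gamma m \subset Gamma l.
Proof.
move=> lelm; apply/subsetP=> g /GammaP[gS [A gE]]; apply/GammaP; split=> //.
by exists (p%:R ^+ (m - l) *: A); rewrite scalerA -exprD subnKC.
Qed.

Lemma Gamma_k : Gamma k = 1%g.
Proof.
apply/trivgP/subsetP=> g /GammaP[gS [A gE]]; rewrite inE; apply/eqP/GLval_inj.
by rewrite gE (chain_pexp chR) scale0r addr0.
Qed.

Lemma map_red_eq0 (A : 'M[R]_2) : map_mx red A = 0 <-> exists B, A = p%:R *: B.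
Proof.
split=> [A0|[B ->]]; last by rewrite map_mxZ (red_p chR) scale0r.
have /fin_all_exists[F FE] (ij : 'I_2 * 'I_2) : exists y, A ij.1 ij.2 = p%:R * y.
  by apply/(chain_ker chR); move/matrixP/(_ ij.1 ij.2): A0; rewrite !mxE.
exists (\matrix_(i, j) F (i, j)); apply/matrixP=> i j; rewrite !mxE.
exact: (FE (i, j)).
Qed.

Lemma pmul_cancel_mx l (A B : 'M[R]_2) : (l < k)%N ->
  p%:R ^+ l *: A = p%:R ^+ l.+1 *: B -> map_mx red A = 0.
Proof.
move=> ltlk /matrixP E; apply/matrixP=> i j; rewrite !mxE.
by apply: (@pmul_cancel _ _ _ _ chR l _ (B i j) ltlk); move: (E i j); rewrite !mxE.
Qed.

Lemma Gamma1_ker : 'ker red_GL = Gamma 1.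
Proof.
apply/setP=> g; rewrite !inE; apply: andb_id2l => gS; apply/eqP/existsP.
  move/(congr1 (@GLval _ _)); rewrite red_GLE GL_1E => E.
  have E' : map_mx red (GLval g : 'M_2) = 1 := E.
  have /map_red_eq0[B BE] : map_mx red ((GLval g : 'M_2) - 1) = 0.
    by rewrite map_mxB E' map_mx1 subrr.
  by exists B; rewrite -BE addrC subrK.
case=> A /eqP E; apply: GLval_inj; rewrite red_GLE E map_mxD map_mxZ (red_p chR).
by rewrite scale0r addr0 map_mx1.
Qed.

Definition traceless : {set 'M['F_p]_2} := [set A : 'M['F_p]_2 | \tr A == 0].

Lemma trace_mx2 (S : nzRingType) (a b c d : S) : \tr (mx2 a b c d) = a + d.
Proof. by rewrite /mxtrace !big_ord_recl big_ord0 !mxE /= addr0. Qed.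

Lemma card_traceless : #|traceless| = (p ^ 3)%N.
Proof.
pose h (u : 'F_p * 'F_p * 'F_p) := mx2 u.1.1 u.1.2 u.2 (- u.1.1).
have -> : traceless = h @: setT.
  apply/setP=> A; rewrite inE; apply/eqP/imsetP => [|[u _ ->]].
    rewrite (mx2_eta A) trace_mx2 => /eqP; rewrite addrC addr_eq0 => /eqP E.
    by exists (A 0 0, A 0 1, A 1 0); rewrite // /h /= E.
  by rewrite trace_mx2 subrr.
rewrite card_imset => [|[[a b] c] [[a' b'] c'] E]; last by have [/= -> -> ->] := mx2P E.
by rewrite cardsT !card_prod card_Fp // !expnS expn0; lia.
Qed.

(** In a product of 1 + p^l A and 1 + p^l B the term p^(2l) A B is invisible modulo p^(l+1) as l >
    0. The determinant 1 + p^l tr A + p^(2l) det A forces tr A to vanish modulo p. *)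
Lemma Gamma_layer l : (0 < l < k)%N ->
  exists f : {morphism Gamma l >-> 'M['F_p]_2},
    [/\ forall g (A : 'M[R]_2), GLval g = 1 + p%:R ^+ l *: A -> f g = map_mx red A,
        'ker f = Gamma l.+1 & f @* Gamma l = traceless].
Proof.
case/andP=> l_gt0 ltlk.
(* [A] is determined only modulo p^(k-l), but since l < k its reduction does not depend on the
   choice made by [pick]. *)
pose f g : 'M['F_p]_2 :=
  if [pick A : 'M[R]_2 | GLval g == 1 + p%:R ^+ l *: A] is Some A then map_mx red A else 0.
have fE g (A : 'M[R]_2) : GLval g = 1 + p%:R ^+ l *: A -> f g = map_mx red A.
  move=> gE; rewrite /f; case: pickP => [B /eqP|/(_ A)]; last by rewrite gE eqxx.
  rewrite gE => /addrI/eqP E; apply/eqP.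
  rewrite -subr_eq0 -map_mxB; apply/eqP/(pmul_cancel_mx (B := 0) ltlk).
  by rewrite scaler0 scalerBr -(eqP E) subrr.
have fM : {in Gamma l &, {morph f : g h / (g * h)%g}}.
  move=> g h /GammaP[gS [A gE]] /GammaP[hS [B hE]].
  rewrite (fE _ _ gE) (fE _ _ hE) FinRing.zmodMgE.
  rewrite (fE _ (A + B + p%:R ^+ l *: (A * B))).
    by rewrite !map_mxD map_mxZ rmorphXn (red_p chR) expr0n; case: (l) l_gt0 => // ? _; rewrite scale0r addr0.
  rewrite GL_ME gE hE mulrDl mul1r mulrDr mulr1 -scalerAl -scalerAr !scalerDr -!addrA.
  by congr (_ + _); rewrite addrCA.
exists (Morphism fM); split=> //=.
  apply/setP=> g; rewrite !inE /=; apply/andP/andP.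
    case=> /andP[gS /existsP[A /eqP gE]]; rewrite (fE _ _ gE) => /eqP /map_red_eq0[B AE].
    by split=> //; apply/existsP; exists B; rewrite gE AE scalerA -exprSr.
  case=> gS /existsP[B /eqP gE].
  have gE' : GLval g = 1 + p%:R ^+ l *: (p%:R *: B) by rewrite gE scalerA -exprSr.
  rewrite gS (fE _ _ gE'); split; first by apply/existsP; exists (p%:R *: B); rewrite gE'.
  by apply/eqP/map_red_eq0; exists B.
apply/setP=> M; rewrite inE; apply/morphimP/idP => [[g _ /GammaP[gS [A gE]] ->]|tM] /=.
  rewrite (fE _ _ gE) trace_map_mx; apply/eqP.
  (* From det = 1, p^l tr A = - p^(2l) det A, which is p^(l+1) times the given witness. *)
  apply: (@pmul_cancel _ _ _ _ chR l _ (- p%:R ^+ l.-1 * \det A)) => //.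
  rewrite in_SL gE (mx2_eta A) in gS; rewrite (mx2_eta A) det_mx2 trace_mx2.
  move/eqP: gS; rewrite one_mx2 scale_mx2 add_mx2 det_mx2.
  have -> : p%:R ^+ l.+1 = p%:R * p%:R ^+ l :> R by rewrite exprS.
  have -> : p%:R ^+ l = p%:R * p%:R ^+ l.-1 :> R by rewrite -exprS prednK.
  move=> E; apply/eqP.
  by rewrite -subr_eq0 -[X in _ == X](subrr 1) -[X in _ == X - _]E; apply/eqP; ring.
move: tM; rewrite (mx2_eta M) trace_mx2 addrC addr_eq0 => /eqP->.
have [a aE] := red_lift red (M 0 0); have [b bE] := red_lift red (M 0 1).
have [c cE] := red_lift red (M 1 0).
set q := p%:R ^+ l : R.
have q0 : red q = 0 by rewrite rmorphXn (red_p chR) expr0n gtn_eqF.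
have u : 1 + q * a \is a GRing.unit.
  by rewrite (unit_redE chR) rmorphD rmorphM q0 mul0r addr0 rmorph1 oner_eq0.
(* [d] solves (1 + q a)(1 + q d) - q^2 b c = 1 and reduces to -a because q reduces to 0. *)
pose d := (1 + q * a)^-1 * (q * b * c - a).
have d1 : (1 + q * a) * (1 + q * d) - (q * b) * (q * c) = 1.
  have -> : (1 + q * a) * (1 + q * d) - q * b * (q * c) =
            1 + q * a + q * ((1 + q * a) * d) - q * b * (q * c) by ring.
  by rewrite /d mulVKr //; ring.
have gE : GLval (sl (1 + q * a) (q * b) (q * c) (1 + q * d)) = 1 + q *: mx2 a b c d.
  by rewrite slE // scale_mx2 one_mx2 add_mx2 !add0r.
exists (sl (1 + q * a) (q * b) (q * c) (1 + q * d)).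
- by apply/GammaP; split; [exact: sl_in | exists (mx2 a b c d)].
- by apply/GammaP; split; [exact: sl_in | exists (mx2 a b c d)].
rewrite (fE _ _ gE) map_mx2 aE bE cE; congr mx2.
rewrite rmorphM rmorphV // rmorphD rmorphB !rmorphM q0 !mul0r rmorph1 addr0 invr1 mul1r sub0r.
by rewrite aE.
Qed.

(** The induction climbs from the trivial group at level k, each layer contributing p^3 traceless
    matrices. *)
Lemma card_Gamma m : (m < k)%N -> #|Gamma (k - m)| = (p ^ (3 * m))%N.
Proof.
elim: m => [|m IHm] ltmk; first by rewrite subn0 Gamma_k cards1.
have [|f [_ kf imf]] := @Gamma_layer (k - m.+1); first by lia.
have E : (k - m.+1).+1 = (k - m)%N by lia.
have := card_morphim f (Gamma_group (k - m.+1)).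
rewrite imf card_traceless setIid kf E => p3.
rewrite -(Lagrange (Gamma_subS (_ : k - m.+1 <= k - m)%N)) ?IHm -?p3 ?(ltnW ltmk) //; last by lia.
by rewrite -expnD; congr (_ ^ _)%N; lia.
Qed.

Lemma Gamma_abelem l : (0 < l < k)%N -> p.-abelem (Gamma l / Gamma l.+1).
Proof.
move=> lk; have [f [_ kf imf]] := Gamma_layer lk.
have := first_isog f; rewrite kf => /isog_abelem->.
exact: abelemS (subsetT _) (mx_Fp_abelem 2 2 pr_p).
Qed.

Lemma Gamma_index l : (0 < l < k)%N -> #|Gamma l : Gamma l.+1| = (p ^ 3)%N.
Proof.
move=> lk; have [f [_ kf imf]] := Gamma_layer lk.
by have := card_morphim f (Gamma_group l); rewrite imf card_traceless setIid kf.
Qed.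

End Reduction.

(** SL is the kernel of the determinant, which maps onto the [#|F|.-1] units as diag(u, 1) shows. *)
Lemma card_SL_field (F : finFieldType) : #|SL F| = (#|F| * #|F|.-1 * #|F|.+1)%N.
Proof.
pose f (g : {'GL_2[F]}) : {unit F} := insubd (1%g : {unit F}) (\det (GLval g)).
have fE g : val (f g) = \det (GLval g) 
    by apply: insubdK; rewrite -topredE /= -unitmxE; have := GL_unit g.
have fM : {in 'GL_2[F] &, {morph f : g h / (g * h)%g}}.
  by move=> g h _ _; apply: val_inj; rewrite fE GL_ME det_mulmx -!fE.
have kf : 'ker (Morphism fM) = SL F.
  by apply/setP=> g; rewrite !inE /= -val_eqE /= fE.
have imf : Morphism fM @* 'GL_2[F] = [set: {unit F}].
  apply/setP=> u; rewrite [RHS]inE; apply/morphimP => /=.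
  have uu : (\det (mx2 (val u) 0 0 1) : F) \is a GRing.unit.
    by rewrite det_mx2 mulr1 mul0r subr0; apply: (valP u).
  exists (insubd (1%g : {'GL_2[F]}) (mx2 (val u) 0 0 1)); rewrite ?inE //.
  apply: val_inj; rewrite fE insubdK -?topredE /= ?unitmxE //.
  by rewrite det_mx2 mulr1 mul0r subr0.
have := card_morphim (Morphism fM) 'GL_2[F].
rewrite imf card_finField_unit setIid kf => cU.
have := Lagrange (subsetT (SL_group F)); rewrite -cU card_GL_2.
have /prednK <- : (0 < #|F|)%N by rewrite (cardD1 0).
move=> /= E.
have : (1 < #|F|)%N by exact: finNzRing_gt1.
move: E; set n := #|F|; case: n => [|[|n]] //= E _.
by apply/eqP; rewrite -(eqn_pmul2r (ltn0Sn n)) E; apply/eqP; ring.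
Qed.

(** * The point stabilizer *)

Section Construction.
Variables (p k o : nat) (R : finComUnitRingType) (red : {rmorphism R -> 'F_p}).
Hypotheses (chR : chain_ring k red) (k2 : (1 < k)%N).
Hypotheses (pE : p = o.*2.+1) (odd_o : odd o) (o3 : (2 < o)%N).
Implicit Types (g h : {'GL_2[R]}) (a b c d x y : R).

Let pr_p : prime p := chain_prime chR.

Lemma card_SL : #|SL R| = (p ^ (3 * k - 2) * (p.-1 * p.+1))%N.
Proof.
have := card_morphim (red_GL_morphism red) (SL R).
rewrite /= (red_GL_im chR) (Gamma1_ker chR) setIid.
have -> : #|SL2 p| = (p * p.-1 * p.+1)%N by rewrite (card_SL_field 'F_p) card_Fp.
move=> E; rewrite -(Lagrange (Gamma_sub p R 1)) -E.
have -> : Gamma_group p R 1 = Gamma_group p R (k - k.-1) by congr Gamma_group; lia.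
rewrite (card_Gamma chR) //; last by lia.
rewrite mulnA mulnA -expnSr -mulnA; congr (_ ^ _ * _)%N; lia.
Qed.

(* With B = g - 1 and s = tr g - 2 one has B^2 = s g. Comparing 1 = g^p with
   the binomial expansion first gives p | s, whence B^p is divisible by p^2 B
   (here p > 3 matters), and then p B = p B v with v^2 divisible by p. *)
Lemma exp_p_in_Gamma g : g \in SL R -> (g ^+ p)%g = 1%g -> g \in Gamma p R k.-1.
Proof.
move=> gS gp; rewrite in_SL in gS.
pose G : 'M[R]_2 := GLval g; pose B := G - 1.
have Gp : G ^+ p = 1 by rewrite -GL_XE gp GL_1E.
have BE : B + 1 = G by rewrite /B subrK.
pose s := \tr G - 2%:R.
have B2 : B ^+ 2 = s *: G.
  rewrite /B sqrrB1 mx2_sqrE ?(eqP gS) // /s scalerBl scaler_nat.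
  by rewrite addrAC subrK.
clearbody B.
have [|y [cBy]] := exprD1_prime B pr_p; first by lia.
rewrite BE Gp -{1}[1]addr0 -addrA => /addrI /esym E0.
(* Squaring B^p gives (s G)^p = s^p, while [E0] makes B^p divisible by p; so s^p is 0 modulo p. *)
have s0 : red s = 0.
  have Bpp : B ^+ p * B ^+ p = mx2 (s ^+ p) 0 0 (s ^+ p).
    by rewrite -exprD addnn -mul2n exprM B2 exprZn Gp one_mx2 scale_mx2 mulr1 mulr0.
  have : s ^+ p = p%:R * (- (B * (1 + B * y)) * B ^+ p) 0 0.
    have := congr1 (fun M : 'M[R]_2 => M 0 0) Bpp; rewrite [RHS]mxE /= => <-.
    have {1}-> : B ^+ p = p%:R *: (- (B * (1 + B * y))).
      by apply/eqP; rewrite scaler_nat mulNrn -mulr_natl mulrA -addr_eq0 addrC E0.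
    by rewrite -scalerAl mxE.
  move/(congr1 red); rewrite rmorphXn rmorphM (red_p chR) mul0r => /eqP.
  by rewrite expf_eq0 => /andP[_ /eqP].
have [s' sE] := (chain_ker chR s).1 s0.
pose P : R := p%:R.
(* B^p = B (s G)^o, and s = p s' yields the factor p^2; the rest is collected in [z]. *)
pose z : 'M[R]_2 := (s' ^+ o * P ^+ (o - 2)) *: G ^+ o.
have Bp : B ^+ p = P *: (P *: (B * z)).
  rewrite {1}pE exprS -mul2n exprM B2 sE exprZn /z -scalerAr -!scalerAr !scalerA.
  congr (_ *: _); rewrite exprMn -/P -{1}(subnK (_ : 2 <= o)%N) ?exprD; last by lia.
  by ring.
clearbody z; pose v := - (B * y + P *: z).
have E1 : P *: B = P *: B * v.
  apply/eqP; rewrite /v mulrN -addr_eq0 mulrDr addrA -E0; apply/eqP.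
  rewrite Bp -scaler_nat -!scalerAl mul1r mulrDr mulr1 scalerDr.
  by rewrite -scalerAr.
pose w := s' *: (G * y * y) + (B * y * z + z * (B * y) + P *: (z * z)).
have v2 : v ^+ 2 = P *: w.
  rewrite /v sqrrN expr2 mulrDl !mulrDr /w scalerDr scalerA -/P -!addrA.
  congr (_ + _).
    by rewrite mulrA -[B * y * B]mulrA -cBy mulrA -expr2 B2 sE -!scalerAl.
  by rewrite -!scalerAl -!scalerAr !scalerDr !addrA.
have En n : P *: B = P *: B * v ^+ n.
  by elim: n => [|n IHn]; rewrite ?mulr1 // exprSr mulrA -IHn -E1.
(* Iterating [E1] 2k times brings in v^(2k) = p^k w^k = 0. *)
have PB0 : P *: B = 0.
  by rewrite (En (2 * k)%N) exprM v2 exprZn (chain_pexp chR) scale0r mulr0.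
have /fin_all_exists[F FE] (ij : 'I_2 * 'I_2) : exists x, B ij.1 ij.2 = P ^+ k.-1 * x.
  by apply: (pmul_eq0 chR); move/matrixP/(_ ij.1 ij.2): PB0; rewrite !mxE.
apply/GammaP; split; first by rewrite in_SL.
exists (\matrix_(i, j) F (i, j)); rewrite -/G -BE addrC; congr (_ + _).
by apply/matrixP=> i j; rewrite !mxE (FE (i, j)).
Qed.

(** * Square roots of 1 and of -1 in SL_2 *)

Definition weyl : {'GL_2[R]} := sl 0 (-1) 1 0.

Lemma weyl_E : GLval weyl = mx2 0 (-1) 1 0. Proof. by apply: slE; ring. Qed.
Lemma weyl_in : weyl \in SL R. Proof. by apply: sl_in; ring. Qed.

(** The trace is a unit, for a (a + d) = (a^2 + b c) + (a d - b c) = 2, and the off-diagonal entries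
    of g^2 are b (a + d) and c (a + d). So g is diagonal with a^2 = a d = 1. *)
Lemma sqr_one g : g \in SL R -> (g ^+ 2)%g = 1%g -> g = 1%g \/ g = negI R.
Proof.
case/SLP=> a [b [c [d [d1 gE]]]] /(congr1 (@GLval _ _)).
rewrite GL_XE gE GL_1E one_mx2 expr2 mul_mx2 => E; have [E1 E2 E3 E4] := mx2P E.
have two : (2%:R : R) \is a GRing.unit.
  by rewrite (unit_redE chR) rmorph_nat (red2_neq0 chR pE).
have u : a + d \is a GRing.unit.
  have : a * (a + d) \is a GRing.unit.
    suff -> : a * (a + d) = 2%:R by [].
    by rewrite -[2%:R]/(1 + 1) -{1}E1 -d1; ring.
  by rewrite unitrM => /andP[].
have b0 : b = 0 by apply: (mulIr u); rewrite mul0r -E2; ring.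
have c0 : c = 0 by apply: (mulIr u); rewrite mul0r -E3; ring.
rewrite b0 c0 ?mulr0 ?addr0 ?subr0 in gE d1 E1.
have da : d = a by rewrite -[LHS]mul1r -E1 -mulrA d1 mulr1.
rewrite -expr2 in E1.
case: (sqr_eq1 chR pE odd_o E1) => aE; [left | right]; apply: GLval_inj.
  by rewrite gE da aE GL_1E one_mx2.
by rewrite gE da aE negI_E one_mx2 opp_mx2 oppr0.
Qed.

(* The matrix with columns v and g v conjugates g to weyl once its determinant
   is 1. With c the lower left entry of g, c times this determinant is a sum of
   two squares X^2 + Y^2 with X, Y independent, so one must solve X^2 + Y^2 = c. *)
Lemma conj_weyl g : g \in SL R -> (g ^+ 2)%g = negI R ->
  exists2 h, h \in SL R & (g ^ h)%g = weyl.
Proof.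
case/SLP=> a [b [c [d [d1 gE]]]] /(congr1 (@GLval _ _)).
rewrite GL_XE gE negI_E one_mx2 opp_mx2 oppr0 expr2 mul_mx2 => E; have [E1 E2 _ _] := mx2P E.
have t0 : a + d = 0.
  have at0 : a * (a + d) = 0.
    have -> : a * (a + d) = (a * a + b * c) + (a * d - b * c) by ring.
    by rewrite E1 d1 addNr.
  rewrite -[LHS]mulr1 -d1.
  have -> : (a + d) * (a * d - b * c) = a * (a + d) * d - (a * b + b * d) * c by ring.
  by rewrite at0 E2 !mul0r subrr.
have {t0} dE : d = - a by apply/eqP; rewrite -addr_eq0 addrC t0.
rewrite {d}dE in gE d1 E E2.
(* If p divided c, then a^2 + b c = -1 would make -1 a square modulo p. *)
have uc : c \is a GRing.unit.
  rewrite (unit_redE chR); apply: contra (red_sqr_neqN1 chR pE odd_o (red a)) => /eqP c0.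
  by have /eqP := congr1 red E1; rewrite rmorphD !rmorphM c0 mulr0 addr0 rmorphN1.
have [s us sE] := unit_sqrPN chR pE odd_o uc.
have [X [Y XY]] : exists X Y, X ^+ 2 + Y ^+ 2 = c.
  case: sE => ->; first by exists s, 0; ring.
  have [u [v uv]] := sum2sqr_N1 chR pE odd_o.
  by exists (s * u), (s * v); rewrite !exprMn -mulrDr uv mulrN1.
(* Completing the square, c times the determinant is (c x - a Y)^2 + Y^2, so [x] is chosen with c x
   - a Y = X. *)
pose x := c^-1 * (X + a * Y).
have cx : c * x = X + a * Y by rewrite mulVKr.
have h1 : x * (c * x - a * Y) - (a * x + b * Y) * Y = 1.
  apply: (mulrI uc).
  have -> : c * (x * (c * x - a * Y) - (a * x + b * Y) * Y) =
    (c * x) * (c * x - a * Y) - (a * (c * x) + b * c * Y) * Y by ring.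
  have -> : b * c = -1 - a * a by rewrite -E1; ring.
  by rewrite cx mulr1 -[RHS]XY; ring.
exists (sl x (a * x + b * Y) Y (c * x - a * Y)); first exact: sl_in.
apply: GLval_inj; rewrite weyl_E; apply: GLval_conj.
rewrite gE slE // !mul_mx2; congr mx2; try by ring.
- have -> : a * (a * x + b * Y) + b * (c * x - a * Y) = (a * a + b * c) * x by ring.
  by rewrite E1; ring.
have -> : c * (a * x + b * Y) + - a * (c * x - a * Y) = (a * a + b * c) * Y by ring.
by rewrite E1; ring.
Qed.

(* The elements 1 + p^(k-1) A with A of zero diagonal; they form the subgroup
   C_p^2 of the point stabilizer. *)
Definition Offdiag : {set {'GL_2[R]}} :=
  [set g in SL R | [exists b : R, exists c : R,
     GLval g == mx2 1 (p%:R ^+ k.-1 * b) (p%:R ^+ k.-1 * c) 1]].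

Lemma OffdiagP g : reflect (g \in SL R /\ exists b c,
    GLval g = mx2 1 (p%:R ^+ k.-1 * b) (p%:R ^+ k.-1 * c) 1) (g \in Offdiag).
Proof.
apply: (iffP setIdP) => -[gS].
  by case/existsP=> b /existsP[c /eqP E]; split=> //; exists b, c.
by case=> b [c E]; split=> //; apply/existsP; exists b; apply/existsP; exists c; rewrite E.
Qed.

Lemma p2k_eq0 : (p%:R : R) ^+ k.-1 * p%:R ^+ k.-1 = 0.
Proof.
rewrite -exprD; have -> : (k.-1 + k.-1 = k + (k - 2))%N by lia.
by rewrite exprD (chain_pexp chR) mul0r.
Qed.

Lemma Offdiag_group_set : group_set Offdiag.
Proof.
apply/group_setP; split=> [|g h /OffdiagP[gS [b [c gE]]] /OffdiagP[hS [b' [c' hE]]]].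
  by apply/OffdiagP; split; [exact: group1 | exists 0, 0; rewrite GL_1E one_mx2 mulr0].
apply/OffdiagP; split; first exact: groupM.
exists (b + b'), (c + c'); rewrite GL_ME gE hE mul_mx2.
move: p2k_eq0; set q := _ ^+ _ => qq; congr mx2; try by ring.
  by rewrite mulrACA qq mul0r addr0 mulr1.
by rewrite mulrACA qq mul0r add0r mulr1.
Qed.
Canonical Offdiag_group := group Offdiag_group_set.

(** The diagonal of [A] counts only modulo p, since p^(k-1) p = 0. *)
Lemma in_Offdiag g (A : 'M[R]_2) : g \in SL R -> GLval g = 1 + p%:R ^+ k.-1 *: A ->
  red (A 0 0) = 0 -> red (A 1 1) = 0 -> g \in Offdiag.
Proof.
move=> gS gE /(chain_ker chR)[x xE] /(chain_ker chR)[y yE].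
apply/OffdiagP; split=> //; exists (A 0 1), (A 1 0).
have pk z : (p%:R : R) ^+ k.-1 * (p%:R * z) = 0.
  by rewrite mulrA -exprSr prednK ?(chain_pexp chR) ?mul0r //; lia.
by rewrite gE {1}(mx2_eta A) one_mx2 scale_mx2 add_mx2 xE yE !pk !addr0 !add0r.
Qed.

Lemma Offdiag_sub_Gamma : Offdiag \subset Gamma p R k.-1.
Proof.
apply/subsetP=> g /OffdiagP[gS [b [c gE]]]; apply/GammaP; split=> //.
by exists (mx2 0 b c 0); rewrite gE one_mx2 scale_mx2 add_mx2 mulr0 !addr0 !add0r.
Qed.

(** On the last layer the map of [Gamma_layer] is injective, so the count takes place among matrices
    over F_p. *)
Lemma card_Offdiag : #|Offdiag| = (p ^ 2)%N.
Proof.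
have [|f [fE kf _]] := @Gamma_layer _ _ _ _ chR k.-1; first by lia.
have injf : 'injm f.
  by rewrite kf prednK ?(Gamma_k chR) //; lia.
rewrite -(card_injm injf Offdiag_sub_Gamma).
pose h (u : 'F_p * 'F_p) := mx2 0 u.1 u.2 0.
have -> : f @* Offdiag = h @: setT.
  apply/setP=> A; apply/morphimP/imsetP => [[g _ /OffdiagP[_ [b [c gE]]] ->]|[[b' c'] _ ->]].
    exists (red b, red c) => //; rewrite (fE _ (mx2 0 b c 0)) ?map_mx2 ?rmorph0 //.
    by rewrite gE one_mx2 scale_mx2 add_mx2 mulr0 !addr0 !add0r.
  have [b bE] := red_lift red b'; have [c cE] := red_lift red c'.
  have d1 : 1 * 1 - p%:R ^+ k.-1 * b * (p%:R ^+ k.-1 * c) = 1.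
    by rewrite mulrACA p2k_eq0 mul0r subr0 mulr1.
  have gEl : sl 1 (p%:R ^+ k.-1 * b) (p%:R ^+ k.-1 * c) 1 \in Offdiag.
    by apply/OffdiagP; split; [exact: sl_in | exists b, c; rewrite slE].
  exists (sl 1 (p%:R ^+ k.-1 * b) (p%:R ^+ k.-1 * c) 1) => //.
    exact: (subsetP Offdiag_sub_Gamma).
  rewrite (fE _ (mx2 0 b c 0)) ?map_mx2 ?rmorph0 ?bE ?cE //.
  by rewrite slE // one_mx2 scale_mx2 add_mx2 mulr0 !addr0 !add0r.
rewrite card_imset => [|[b c] [b' c'] E]; last by have [_ /= -> ->] := mx2P E.
by rewrite cardsT card_prod card_Fp // expnS expn1.
Qed.

Lemma Offdiag_abelem : p.-abelem Offdiag.
Proof.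
have [|f [fE kf _]] := @Gamma_layer _ _ _ _ chR k.-1; first by lia.
have injf : 'injm f.
  by rewrite kf prednK ?(Gamma_k chR) //; lia.
rewrite -(injm_abelem injf Offdiag_sub_Gamma).
exact: abelemS (subsetT _) (mx_Fp_abelem 2 2 pr_p).
Qed.

Lemma slV a b c d : a * d - b * c = 1 -> (GLval (sl a b c d))^-1 = mx2 d (- b) (- c) a.
Proof.
move=> d1; apply: (mulrI (GL_unit (sl a b c d))); rewrite divrr ?GL_unit //.
by rewrite slE // mul_mx2 one_mx2 -d1; congr mx2; ring.
Qed.

(** As [A] is traceless modulo p, a conjugation need only kill its upper left entry modulo p; the
    other diagonal entry follows by invariance of the trace. *)
Lemma conj_Offdiag g : g \in Gamma p R k.-1 -> exists2 h, h \in SL R & (g ^ h)%g \in Offdiag.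
Proof.
move=> gG; have /GammaP[gS [A gE]] := gG.
have [|f [fE _ imf]] := @Gamma_layer _ _ _ _ chR k.-1; first by lia.
have trA : red (A 0 0) = - red (A 1 1).
  have : f g \in traceless p by rewrite -imf mem_morphim.
  rewrite inE (fE _ _ gE) (mx2_eta A) map_mx2 trace_mx2.
  by rewrite !mxE /= addr_eq0 => /eqP.
suff [x [y [z [w [d1 E]]]]] : exists x y z w, x * w - y * z = 1 /\
    red ((w * A 0 0 - y * A 1 0) * x + (w * A 0 1 - y * A 1 1) * z) = 0.
  exists (sl x y z w); first exact: sl_in.
  pose A' := mx2 w (- y) (- z) x * A * mx2 x y z w.
  have A'E : A' = mx2 w (- y) (- z) x * A * mx2 x y z w by [].
  apply: (in_Offdiag (A := A')); first by rewrite groupJ ?sl_in.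
  - rewrite GLval_conjE gE slV // slE // A'E.
    rewrite mulrDr mulr1 mulrDl -scalerAr -scalerAl; congr (_ + _).
    by rewrite mul_mx2 one_mx2 -d1; congr mx2; ring.
  - by rewrite A'E (mx2_eta A) !mul_mx2 mxE /= !mulNr E.
  have trA' : A' 0 0 + A' 1 1 = A 0 0 + A 1 1.
    rewrite A'E (mx2_eta A) !mul_mx2 !mxE /= -[RHS]mul1r -d1; ring.
  have := congr1 red trA'; rewrite !rmorphD trA addNr.
  have -> : red (A' 0 0) = 0; last by rewrite add0r.
  by rewrite A'E (mx2_eta A) !mul_mx2 mxE /= !mulNr E.
(* If an off-diagonal entry is a unit, a unitriangular matrix suffices. Otherwise A is diag(a, -a)
   modulo p, and the matrix with columns (1, 1) and (-1/2, 1/2) works. *)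
have [c0|uc] := eqVneq (red (A 1 0)) 0; last first.
  exists 1, ((A 1 0)^-1 * A 0 0), 0, 1; split; first by ring.
  rewrite mulr0 addr0 mulr1 mul1r mulrAC mulVr ?mul1r ?subrr ?rmorph0 //.
  exact: (chain_unit chR).
have [b0|ub] := eqVneq (red (A 0 1)) 0; last first.
  exists 1, 0, (- ((A 0 1)^-1 * A 0 0)), 1; split; first by ring.
  rewrite !mul0r !subr0 !mul1r mulr1 mulrN mulVKr ?subrr ?rmorph0 //.
  exact: (chain_unit chR).
have two : (2%:R : R) \is a GRing.unit.
  by rewrite (unit_redE chR) rmorph_nat (red2_neq0 chR pE).
pose e : R := 2%:R^-1.
have e2 : e + e = 1 by rewrite -mulr2n -mulr_natl divrr.
exists 1, (- e), 1, e; split; first by rewrite mul1r mulr1 opprK.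
rewrite !mulr1 !mulNr !opprK !rmorphD !rmorphM c0 b0 trA; ring.
Qed.

(** * The dihedral part of the stabilizer and its action on [Offdiag] *)

Variable z : R.
Hypotheses (zo : z ^+ o = 1) (prim_z : o.-primitive_root (red z)).
Let uz : z \is a GRing.unit.
Proof. by rewrite -(unitrX_pos _ (_ : 0 < o)%N) ?zo ?unitr1 //; lia. Qed.

Definition tdiag : {'GL_2[R]} := sl z 0 0 z^-1.

Let tdiag1 : z * z^-1 - 0 * 0 = 1. Proof. by rewrite mulr0 subr0 divrr. Qed.

Lemma tdiag_in : tdiag \in SL R. Proof. exact: sl_in. Qed.

Lemma tdiagX n : GLval (tdiag ^+ n)%g = mx2 (z ^+ n) 0 0 (z^-1 ^+ n).
Proof.
rewrite GL_XE slE //; elim: n => [|n IHn]; first by rewrite !expr0 one_mx2.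
by rewrite exprS IHn mul_mx2 !mulr0 !mul0r !addr0 add0r -!exprS.
Qed.

Lemma order_tdiag : #[tdiag] = o.
Proof.
apply/eqP; rewrite eqn_dvd order_dvdn; apply/andP; split.
  by apply/eqP/GLval_inj; rewrite tdiagX exprVn zo invr1 GL_1E one_mx2.
have := tdiagX #[tdiag]; rewrite expg_order GL_1E one_mx2 => E.
have [z1 _ _ _] := mx2P E.
by rewrite (prim_order_dvd prim_z) -rmorphXn -z1 rmorph1.
Qed.

Lemma two_neq0 : (2%:R : R) != 0.
Proof.
apply: contra_neq (red2_neq0 chR pE odd_o) => two.
by rewrite -(rmorph_nat red) two rmorph0.
Qed.

Lemma negI_neq1 : negI R != 1%g.
Proof. by rewrite -order_gt1 (order_negI two_neq0). Qed.

Lemma weyl_sqr : (weyl ^+ 2)%g = negI R.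
Proof.
apply: GLval_inj; rewrite GL_XE weyl_E negI_E expr2 mul_mx2 one_mx2 opp_mx2.
by congr mx2; ring.
Qed.

Lemma order_weyl : #[weyl] = 4%N.
Proof.
have : (#[weyl] %| 2 ^ 2)%N.
  by rewrite order_dvdn -[(2 ^ 2)%N]/(2 * 2)%N expgM weyl_sqr expgS expg1 negI_sqr.
case/(dvdn_pfactor _ _ (isT : prime 2)) => m le2 om; rewrite om.
have : ~~ (#[weyl] %| 2)%N by rewrite order_dvdn weyl_sqr negI_neq1.
by rewrite om; case: m le2 {om} => [|[|[|]]].
Qed.

Lemma tdiag_weyl : (tdiag ^ weyl)%g = tdiag^-1%g.
Proof.
apply: GLval_inj; apply: GLval_conj.
by rewrite weyl_E GL_VE slV // slE // !mul_mx2; congr mx2; ring.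
Qed.

(* Modulo its center {1, -1}, this is the dihedral group of order p - 1. *)
Definition TorusN : {group {'GL_2[R]}} := <[tdiag]> <*> <[weyl]>.

Lemma TorusN_norm : <[weyl]> \subset 'N(<[tdiag]>).
Proof. by rewrite cycle_subG; apply/normP; rewrite -cycleJ tdiag_weyl cycleV. Qed.

Lemma card_TorusN : #|TorusN| = (4 * o)%N.
Proof.
rewrite /= norm_joinEr ?TorusN_norm // coprime_cardMg -?orderE order_tdiag order_weyl 1?mulnC //.
by rewrite (@coprimeXr 2 o 2) // coprimen2.
Qed.

Lemma weyl_TorusN : weyl \in TorusN.
Proof. by rewrite mem_gen // inE cycle_id orbT. Qed.

Lemma tdiag_TorusN : tdiag \in TorusN.
Proof. by rewrite mem_gen // inE cycle_id. Qed.

(** Both generators square to -1, so modulo {1, -1} they become the two involutions that the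
    dihedral criterion asks for. *)
Lemma TorusN_gen : <<[set weyl; (weyl * tdiag)%g]>> = TorusN.
Proof.
apply/eqP; rewrite eqEsubset gen_subG join_subG !cycle_subG; apply/and3P; split.
- by apply/subsetP=> x; rewrite !inE => /orP[] /eqP->; rewrite ?groupM ?weyl_TorusN ?tdiag_TorusN.
- rewrite -[X in X \in _](mulKg weyl); apply: groupM; last exact/mem_gen/set22.
  by rewrite groupV; apply/mem_gen/set21.
exact/mem_gen/set21.
Qed.

Lemma negI_TorusN : negI R \in TorusN.
Proof. by rewrite -weyl_sqr groupX ?weyl_TorusN. Qed.

(** The monomial matrices: a group described by entries that contains [TorusN], so that normalizing
    [Offdiag] becomes a matrix computation. *)
Definition mono : {set {'GL_2[R]}} := [set g in SL R |
  (GLval g 0 1 == 0) && (GLval g 1 0 == 0) || (GLval g 0 0 == 0) && (GLval g 1 1 == 0)].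

Lemma monoP g : reflect (g \in SL R /\ exists a b,
    GLval g = mx2 a 0 0 b \/ GLval g = mx2 0 a b 0) (g \in mono).
Proof.
apply: (iffP setIdP) => -[gS].
  case/orP=> /andP[/eqP E1 /eqP E2]; split=> //.
    by exists (GLval g 0 0), (GLval g 1 1); left; rewrite {1}(mx2_eta (GLval g)) E1 E2.
  by exists (GLval g 0 1), (GLval g 1 0); right; rewrite {1}(mx2_eta (GLval g)) E1 E2.
by case=> a [b [|] E]; split=> //; rewrite E !mxE /= !eqxx ?orbT.
Qed.

Lemma mono_group_set : group_set mono.
Proof.
apply/group_setP; split=> [|g h /monoP[gS [a [b gE]]] /monoP[hS [c [d hE]]]].
  by apply/monoP; split; [exact: group1 | exists 1, 1; left; rewrite GL_1E one_mx2].
apply/monoP; split; first exact: groupM.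
rewrite GL_ME; case: gE => ->; case: hE => ->; rewrite mul_mx2 !(mulr0, mul0r, addr0, add0r).
- by exists (a * c), (b * d); left.
- by exists (a * c), (b * d); right.
- by exists (a * d), (b * c); right.
by exists (a * d), (b * c); left.
Qed.
Canonical mono_group := group mono_group_set.

Lemma TorusN_mono : TorusN \subset mono.
Proof.
rewrite join_subG !cycle_subG; apply/andP; split; apply/monoP.
  by split; [exact: tdiag_in | exists z, z^-1; left; rewrite slE].
by split; [exact: weyl_in | exists (-1), 1; right; rewrite weyl_E].
Qed.

Lemma mono_norm : mono \subset 'N(Offdiag).
Proof.
apply/subsetP=> h /monoP[hS [x [y hE]]]; rewrite inE.
apply/subsetP=> _ /imsetP[g /OffdiagP[gS [b [c gE]]] ->].
have dh : \det (GLval h) = 1 by move: hS; rewrite in_SL => /eqP.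
apply/OffdiagP; split; first by rewrite groupJ.
case: hE => hE; rewrite hE det_mx2 !(mulr0, mul0r, subr0, sub0r) in dh.
  exists (y * b * y), (x * c * x); apply: GLval_conj; rewrite gE hE !mul_mx2.
  move: (_ ^+ _) => q; congr mx2; try by ring.
    by rewrite -[RHS]mul1r -dh; ring.
  by rewrite -[RHS]mul1r -dh; ring.
exists (- (x * c * x)), (- (y * b * y)); apply: GLval_conj; rewrite gE hE !mul_mx2.
move: (_ ^+ _) => q; congr mx2; try by ring.
  by rewrite -[RHS]mul1r -dh; ring.
by rewrite -[RHS]mul1r -dh; ring.
Qed.

(** * The preimage of the stabilizer: its index and its core *)

Definition StabSL : {group {'GL_2[R]}} := Offdiag_group <*> TorusN.

Lemma TorusN_SL : TorusN \subset SL R.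
Proof. by apply: subset_trans TorusN_mono _; apply/subsetP=> g /monoP[]. Qed.

Lemma Offdiag_SL : Offdiag \subset SL R.
Proof. by apply/subsetP=> g /OffdiagP[]. Qed.

Lemma StabSL_SL : StabSL \subset SL R.
Proof. by rewrite join_subG Offdiag_SL TorusN_SL. Qed.

Lemma coprime_p_TorusN n : coprime (p ^ n) #|TorusN|.
Proof.
apply: coprimeXl; rewrite card_TorusN prime_coprime // Euclid_dvdM // negb_or.
by rewrite !gtnNdvd //; lia.
Qed.

Lemma Offdiag_TorusN_TI : Offdiag :&: TorusN = 1%g.
Proof.
apply: (@coprime_TIg _ Offdiag_group).
by rewrite /= card_Offdiag coprime_p_TorusN.
Qed.

Lemma TorusN_norm_Offdiag : TorusN \subset 'N(Offdiag).
Proof. exact: subset_trans TorusN_mono mono_norm. Qed.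

Lemma StabSLE : StabSL = (Offdiag * TorusN)%g :> {set _}.
Proof. exact: (@norm_joinEr _ Offdiag_group TorusN TorusN_norm_Offdiag). Qed.

Lemma card_StabSL : #|StabSL| = (p ^ 2 * (4 * o))%N.
Proof.
rewrite StabSLE -card_Offdiag -card_TorusN.
exact: (@TI_cardMg _ Offdiag_group TorusN Offdiag_TorusN_TI).
Qed.

Lemma StabSL_index : #|SL R : StabSL| = (p ^ (3 * k - 4) * (p + 1) %/ 2)%N.
Proof.
apply/eqP; rewrite -(eqn_pmul2l (cardG_gt0 StabSL)) Lagrange ?StabSL_SL //.
rewrite card_SL card_StabSL.
have -> : (p ^ (3 * k - 4) * (p + 1) %/ 2 = p ^ (3 * k - 4) * o.+1)%N.
  have -> : (p + 1 = o.+1 * 2)%N by lia.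
  by rewrite mulnA mulnK.
have -> : (3 * k - 2 = 2 + (3 * k - 4))%N by lia.
rewrite expnD; have -> : (p.-1 * p.+1 = 4 * o * o.+1)%N by rewrite pE /=; lia.
by apply/eqP; ring.
Qed.

Lemma Gamma1_TorusN_TI : Gamma p R 1 :&: TorusN = 1%g.
Proof.
apply: (@coprime_TIg _ (Gamma_group p R 1)).
have -> : Gamma_group p R 1 = Gamma_group p R (k - k.-1) by congr Gamma_group; lia.
by rewrite (card_Gamma chR k2) ?coprime_p_TorusN //; lia.
Qed.

Lemma Offdiag_sub_Gamma1 : Offdiag \subset Gamma p R 1.
Proof. by apply: subset_trans (Offdiag_sub_Gamma) _; apply: Gamma_subS; lia. Qed.

(** [Gamma p R 1] is a p-group containing [Offdiag], and [TorusN] has order prime to p; hence the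
    [TorusN] factor of g is trivial. *)
Lemma StabSL_Gamma1 g : g \in StabSL -> g \in Gamma p R 1 -> g \in Offdiag.
Proof.
rewrite StabSLE => /mulsgP[e n eE nW ->] gG.
have nG : n \in Gamma p R 1.
  by rewrite -(groupMl n (x := e)) // (subsetP Offdiag_sub_Gamma1).
have : n \in Gamma p R 1 :&: TorusN by rewrite inE nG.
by rewrite Gamma1_TorusN_TI => /set1gP->; rewrite mulg1.
Qed.

Lemma StabSL_red g a b c d : g \in StabSL -> GLval g = mx2 a b c d ->
  red b = 0 /\ red c = 0 \/ red a = 0 /\ red d = 0.
Proof.
rewrite StabSLE => /mulsgP[e n /OffdiagP[_ [x [y eE]]] nW ->].
have q0 t : red (p%:R ^+ k.-1 * t) = 0.
  by rewrite rmorphM rmorphXn (red_p chR) expr0n gtn_eqF ?mul0r //; lia.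
have /monoP[_ [u [v nE]]] := subsetP TorusN_mono _ nW.
rewrite GL_ME eE; case: nE => ->; rewrite mul_mx2 !(mulr0, add0r, addr0) => E.
  by left; have [_ <- <- _] := mx2P E; rewrite !(rmorphM red (_ * _)) !q0 !mul0r.
by right; have [<- _ _ <-] := mx2P E; rewrite !(rmorphM red (_ * _)) !q0 !mul0r.
Qed.

(** Conjugation by the two elementary transvections preserves the core and mixes diagonal with
    off-diagonal entries; the shape of [StabSL] then constrains all of them. *)
Lemma core_unip g a b c d : g \in gcore StabSL (SL R) -> GLval g = mx2 a b c d ->
  exists g1 g2, [/\ g1 \in gcore StabSL (SL R), GLval g1 = mx2 (a - c) (a + b - c - d) c (c + d),
    g2 \in gcore StabSL (SL R), GLval g2 = mx2 (a + b) b (c + d - a - b) (d - b) &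
    g \in Gamma p R 1 -> g1 \in Gamma p R 1 /\ g2 \in Gamma p R 1].
Proof.
move=> gC gE.
have u1 : (1 : R) * 1 - 1 * 0 = 1 by ring.
have u2 : (1 : R) * 1 - 0 * 1 = 1 by ring.
have nC h : h \in SL R -> (g ^ h)%g \in gcore StabSL (SL R).
  by move=> hS; rewrite memJ_norm // (subsetP (gcore_norm _ _)).
have nG h : h \in SL R -> g \in Gamma p R 1 -> (g ^ h)%g \in Gamma p R 1.
  by move=> hS gG; rewrite memJ_norm // (subsetP (Gamma_norm _ _ _)).
pose x : {'GL_2[R]} := sl 1 1 0 1; pose y : {'GL_2[R]} := sl 1 0 1 1.
exists (g ^ x)%g, (g ^ y)%g; split; rewrite ?nC ?sl_in //.
- by apply: GLval_conj; rewrite slE // gE !mul_mx2; congr mx2; ring.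
- by apply: GLval_conj; rewrite slE // gE !mul_mx2; congr mx2; ring.
by move=> gG; rewrite !nG ?sl_in.
Qed.

(** Such a g lies in [Offdiag], and so do its two conjugates; their upper left entries, 1 minus the
    lower and 1 plus the upper off-diagonal entry of g, must be 1. *)
Lemma core_Gamma1 g : g \in gcore StabSL (SL R) -> g \in Gamma p R 1 -> g = 1%g.
Proof.
move=> gC gG; have gH := subsetP (gcore_sub _ _) _ gC.
have /OffdiagP[_ [b [c gE]]] := StabSL_Gamma1 gH gG.
have [g1 [g2 [C1 E1 C2 E2 /(_ gG)[G1 G2]]]] := core_unip gC gE.
have /OffdiagP[_ [b1 [c1 E1']]] := StabSL_Gamma1 (subsetP (gcore_sub _ _) _ C1) G1.
have /OffdiagP[_ [b2 [c2 E2']]] := StabSL_Gamma1 (subsetP (gcore_sub _ _) _ C2) G2.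
have [Ec _ _ _] := mx2P (etrans (esym E1) E1').
have [Eb _ _ _] := mx2P (etrans (esym E2) E2').
have c0 : p%:R ^+ k.-1 * c = 0 by apply/eqP; rewrite -oppr_eq0 -(inj_eq (addrI 1)) Ec addr0.
have b0 : p%:R ^+ k.-1 * b = 0 by apply/eqP; rewrite -(inj_eq (addrI 1)) Eb addr0.
by apply: GLval_inj; rewrite gE b0 c0 GL_1E one_mx2.
Qed.

Lemma negI_sub_StabSL : <[negI R]> \subset StabSL.
Proof. by rewrite cycle_subG mem_gen // inE negI_TorusN orbT. Qed.

Lemma red1_Gamma1 g : g \in SL R -> map_mx red (GLval g) = 1 -> g \in Gamma p R 1.
Proof.
move=> gS g1; rewrite -(Gamma1_ker chR); apply/kerP => //.
by apply: GLval_inj; rewrite /= red_GLE g1.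
Qed.

(** Modulo p a core element and its conjugate by a transvection are both monomial, which with
    determinant 1 leaves only the scalars 1 and -1. Up to sign the element lies in [Gamma p R 1], so
    [core_Gamma1] applies. *)
Lemma core_StabSL : gcore StabSL (SL R) = <[negI R]>.
Proof.
apply/eqP; rewrite eqEsubset gcore_max ?negI_sub_StabSL ?cents_norm ?negI_center // andbT.
apply/subsetP=> g gC.
have gH := subsetP (gcore_sub _ _) _ gC; have gS := subsetP StabSL_SL _ gH.
have /SLP[a [b [c [d [d1 gE]]]]] := gS.
have [g1 [_ [C1 E1 _ _ _]]] := core_unip gC gE.
have rd1 : red a * red d - red b * red c = 1 by rewrite -!rmorphM -rmorphB d1 rmorph1.
have H1 := StabSL_red (subsetP (gcore_sub _ _) _ C1) E1.
rewrite !rmorphB !rmorphD in H1.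
have [b0 [c0 ad]] : red b = 0 /\ red c = 0 /\ red a = red d.
  have nz : (0 : 'F_p) <> 1 by move/eqP; rewrite eq_sym oner_eq0.
  case: (StabSL_red gH gE) => -[E E']; case: H1; rewrite ?E ?E' !(addr0, subr0, add0r, sub0r).
  - by case=> /eqP; rewrite subr_eq0 => /eqP.
  - by case=> a0; move: rd1; rewrite a0 E !mul0r subrr => /nz.
  - by case=> _ c0; move: rd1; rewrite E c0 mul0r mulr0 subrr => /nz.
  - by case=> _ c0; move: rd1; rewrite E c0 mul0r mulr0 subrr => /nz.
have mE : map_mx red (GLval g) = (red a)%:M.
  by rewrite gE map_mx2 b0 c0 -ad scalar_mx2.
have : red a ^+ 2 == 1 by rewrite expr2 {2}ad -[X in X == _]subr0 -(mul0r (red c)) -b0 rd1.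
rewrite sqrf_eq1 => /orP[] /eqP aE.
  by rewrite (core_Gamma1 gC) ?group1 // red1_Gamma1 // mE aE.
have gN : (negI R * g)%g \in gcore StabSL (SL R).
  rewrite groupM // (subsetP (gcore_max _ _) _ (cycle_id _)) ?negI_sub_StabSL //.
  by rewrite cents_norm ?negI_center.
have : (negI R * g)%g = 1%g.
  apply: core_Gamma1 gN (red1_Gamma1 _ _); first by rewrite groupM ?negI_in.
  by rewrite mul_negI map_mxN mE aE raddfN opprK.
by move/eqP; rewrite -eq_invg_mul => /eqP<-; rewrite groupV cycle_id.
Qed.

(** * The permutation group *)

Local Open Scope group_scope.

Let Z : {group {'GL_2[R]}} := <[negI R]>.
(** The preimage of the scalars under reduction, and also of N under the quotient map by {1, -1}:
    both PSL_2(p) and X/N are thus compared with SL/B. *)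
Let B : {group {'GL_2[R]}} := Gamma_group p R 1 <*> Z.

Lemma Gamma1Z_normal : B <| SL R.
Proof.
rewrite normalY ?Gamma_normal //.
rewrite /normal cycle_subG negI_in /=.
by rewrite cents_norm // negI_center.
Qed.

Lemma red_GL_scalar : red_GL red @* B = scalar_SL2 p.
Proof.
have ZS : Z \subset SL R by rewrite cycle_subG negI_in.
rewrite /B /= norm_joinEr; last by apply: subset_trans ZS (Gamma_norm _ _ _).
rewrite morphimMl ?Gamma_sub // -[gval (Gamma_group _ _ _)]/(Gamma p R 1) -(Gamma1_ker chR).
rewrite morphim_ker mul1g.
rewrite morphim_cycle ?negI_in //= [red_GL red _]map_GL_negI.
exact/esym/(@scalar_SL 'F_p)/(red2_neq0 chR pE odd_o).
Qed.

Lemma SL_quotient : SL R / B \isog red_GL red @* SL R / red_GL red @* B.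
Proof.
apply: morphim_quotient_isog Gamma1Z_normal _ => //.
by rewrite (Gamma1_ker chR) subIset // joing_subl orbT.
Qed.

Variables (rT : finGroupType) (f : {morphism SL R >-> rT}).
Hypothesis kf : 'ker f = <[negI R]>.

Lemma cardZ : #|'ker f| = 2%N.
Proof. by rewrite kf -orderE (order_negI two_neq0). Qed.

Lemma kerP2 g : g \in 'ker f -> g = 1 \/ g = negI R.
Proof.
rewrite kf cycle2g ?(order_negI two_neq0) // => /set2P[] ->; by [left | right].
Qed.

Lemma f_negI : f (negI R) = 1.
Proof. by apply: mker; rewrite kf cycle_id. Qed.

(** The kernel has order 2 and [Gamma p R 1] has odd order, so f is faithful on all congruence
    subgroups of positive level. *)
Lemma Gamma_ker_TI l : (0 < l)%N -> Gamma p R l :&: 'ker f = 1.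
Proof.
move=> l0; apply/trivgP.
apply: subset_trans (setSI _ (Gamma_subS p R l0)) _; apply/trivgP.
apply: (@coprime_TIg _ (Gamma_group p R 1)).
have -> : Gamma_group p R 1 = Gamma_group p R (k - k.-1) by congr Gamma_group; lia.
by rewrite /= (card_Gamma chR k2) ?cardZ ?coprimeXl // ?coprimen2 ?pE /= ?odd_double //; lia.
Qed.

Lemma f_Gamma_layer l : (0 < l < k)%N -> f @* Gamma p R l / f @* Gamma p R l.+1 \isog elemC p 3.
Proof.
move=> lk; have l0 : (0 < l)%N by case/andP: lk.
have nsG : Gamma_group p R l.+1 <| Gamma_group p R l.
  apply: normalS (Gamma_normal p R l.+1); [exact: Gamma_subS | exact: Gamma_sub].
have K : 'ker_(Gamma_group p R l) f \subset Gamma_group p R l.+1 by rewrite /= Gamma_ker_TI ?sub1G.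
have I := morphim_quotient_isog (Gamma_sub p R l) nsG K.
apply: isog_trans (isog_symr I) _.
apply: (isog_elemC pr_p (Gamma_abelem chR lk)).
by rewrite card_quotient ?normal_norm // (Gamma_index chR).
Qed.

Lemma f_quotient : f @* SL R / f @* Gamma p R 1 \isog PSL2 p.
Proof.
have kB : 'ker_(SL R) f \subset B by rewrite kf subIset // joing_subr orbT.
have I := morphim_quotient_isog (subxx _) Gamma1Z_normal kB.
have ZS : Z \subset SL R by rewrite cycle_subG negI_in.
have fB : f @* B = f @* Gamma p R 1.
  rewrite /B /= norm_joinEr; last by apply: subset_trans ZS (Gamma_norm _ _ _).
  by rewrite morphimMl ?Gamma_sub // /Z /= -kf morphim_ker mulg1.
have := isog_trans (isog_symr I) SL_quotient.
by rewrite fB red_GL_scalar /= (red_GL_im chR).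
Qed.

(* A preimage g of x satisfies g^p = 1 or g^p = -1; in the second case
   - g is another preimage, and (- g)^p = 1 because p is odd. *)
Lemma order_p_image (x : rT) : x \in f @* SL R -> x ^+ p = 1 ->
  exists2 g, g \in Gamma p R k.-1 & x = f g.
Proof.
case/morphimP=> g _ gS -> xp.
have : g ^+ p \in 'ker f by apply/kerP; rewrite ?groupX // morphX.
case/kerP2=> gp.
  by exists g => //; apply: exp_p_in_Gamma.
exists (negI R * g); last by rewrite morphM ?negI_in // f_negI mul1g.
apply: exp_p_in_Gamma; first by rewrite groupM ?negI_in.
rewrite expgMn; last exact: negI_comm.
by rewrite gp pE expgS -mul2n expgM expgS expg1 negI_sqr expg1n mulg1 negI_sqr.
Qed.

(** This gives N the index p (p - 1)(p + 1) / 2, written without division. *)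
Lemma card_f_Gamma1 : (#|f @* Gamma p R 1| * p * (p.-1 * p.+1) = 2 * #|f @* SL R|)%N.
Proof.
have -> : #|f @* Gamma p R 1| = (p ^ (3 * k.-1))%N.
  have -> : f @* Gamma p R 1 = restrm (Gamma_sub p R 1) f @* Gamma p R 1.
    by rewrite morphim_restrm setIid.
  rewrite card_injm ?subxx //; last by rewrite ker_restrm Gamma_ker_TI.
  have -> : Gamma p R 1 = Gamma p R (k - k.-1) by congr Gamma; lia.
  by rewrite (card_Gamma chR k2) //; lia.
have sK : 'ker f \subset SL R by apply/subsetP=> x /dom_ker.
have := Lagrange sK; rewrite cardZ card_morphim setIid => ->.
rewrite card_SL -expnSr; congr (_ ^ _ * _)%N; lia.
Qed.

(** The order of a complement would be divisible by p, so it would contain an element of order p; by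
    [order_p_image] that element lies in N. *)
Lemma f_nonsplit : ~~ [splits f @* SL R, over f @* Gamma p R 1].
Proof.
apply/negP=> /splitsP[K /complP[TI NK]].
have pK : (p %| #|K|)%N.
  have := card_f_Gamma1; rewrite -[f @* SL R in RHS]NK TI_cardMg // => E.
  have {}E : (p * (p.-1 * p.+1) = 2 * #|K|)%N.
    by apply/eqP; rewrite -(eqn_pmul2l (cardG_gt0 (f @* Gamma_group p R 1))) /= mulnA E mulnCA.
  have : (p %| 2 * #|K|)%N by rewrite -E dvdn_mulr.
  by rewrite Euclid_dvdM // gtnNdvd //=; lia.
have [x xK ox] := Cauchy pr_p pK.
have xX : x \in f @* SL R by rewrite -NK (subsetP (mulG_subr _ _)).
have [|g gG xE] := order_p_image xX; first by rewrite -ox expg_order.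
have : x \in f @* Gamma p R 1 :&: K.
  rewrite inE xK andbT xE mem_morphim ?(subsetP (Gamma_sub _ _ _) _ gG) //.
  by apply: (subsetP (Gamma_subS p R _)) gG; lia.
rewrite TI => /set1gP x1; have := prime_gt1 pr_p.
by rewrite -ox x1 order1.
Qed.

Lemma f_sdprod : f @* Offdiag ><| f @* TorusN = f @* StabSL.
Proof.
have nWE := morphim_norms f TorusN_norm_Offdiag.
have TI : f @* Offdiag :&: f @* TorusN = 1.
  apply: coprime_TIg; apply: (coprime_dvdl (dvdn_morphim _ _)).
  apply: (coprime_dvdr (dvdn_morphim _ _)).
  rewrite /= card_Offdiag.
  exact: coprime_p_TorusN.
have := @sdprodE _ (f @* Offdiag_group)%G (f @* TorusN)%G nWE TI.
move=> /= ->; rewrite StabSLE morphimMl // ?Offdiag_SL //.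
Qed.

Lemma f_Offdiag_isog : f @* Offdiag \isog elemC p 2.
Proof.
have K : Offdiag :&: 'ker f = 1.
  apply/trivgP; rewrite -(Gamma_ker_TI (isT : 0 < 1)%N) setSI //.
  exact: Offdiag_sub_Gamma1.
have inj : 'injm (restrm Offdiag_SL f) by rewrite ker_restrm K.
have cE : #|f @* Offdiag| = (p ^ 2)%N.
  have -> : f @* Offdiag = restrm Offdiag_SL f @* Offdiag by rewrite morphim_restrm setIid.
  by rewrite (card_injm inj (subxx Offdiag_group)) /= card_Offdiag.
exact: (@isog_elemC _ (f @* Offdiag_group)%G _ _ pr_p (morphim_abelem f Offdiag_abelem) cE).
Qed.

Lemma f_involution g : g \in SL R -> g ^+ 2 = negI R -> #[f g] = 2%N.
Proof.
move=> gS g2; apply: nt_prime_order => //; first by rewrite -morphX // g2 f_negI.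
apply/eqP => fg1; have gK : g \in 'ker f by apply/kerP.
have := order_dvdG gK; rewrite cardZ order_dvdn g2.
exact/negP/negI_neq1.
Qed.

Lemma f_TorusN_isog : f @* TorusN \isog 'D_(p - 1).
Proof.
have weyl_S := weyl_in; have dS := tdiag_in.
have WS : TorusN \subset SL R := TorusN_SL.
have KW : 'ker f \subset TorusN by rewrite kf cycle_subG negI_TorusN.
apply: (@isog_dihedral_gen _ _ (f weyl) (f (weyl * tdiag))).
- rewrite /= -TorusN_gen morphim_gen; last first.
    by apply/subsetP=> x /set2P[] ->; rewrite ?groupM.
  rewrite morphimU !morphim_set1 ?groupM //.
- exact: f_involution weyl_sqr.
- apply: f_involution; first exact: groupM.
  rewrite expgS expg1 -mulgA (mulgA tdiag) (conjgC tdiag).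
  rewrite tdiag_weyl -mulgA mulVg mulg1.
  by rewrite -weyl_sqr expgS expg1.
(* If the two involutions agreed, [tdiag] would lie in the kernel, of order 2, although its order is
   o > 2. *)
- apply/eqP; rewrite morphM // => /(congr1 (mulg (f weyl)^-1)).
  rewrite mulKg mulVg => fd1; have dK : tdiag \in 'ker f by apply/kerP.
  have := order_dvdG dK; rewrite cardZ order_tdiag.
  by rewrite gtnNdvd.
have := Lagrange KW; rewrite cardZ card_TorusN.
rewrite card_morphim (setIidPr WS) => cW.
apply/eqP; rewrite -(eqn_pmul2l (ltn0Sn 1)); apply/eqP.
by apply: etrans cW _; rewrite pE; lia.
Qed.

Lemma order_p_conj (x : rT) : x \in f @* SL R -> x ^+ p = 1 ->
  exists2 y, y \in f @* SL R & x ^ y \in f @* StabSL.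
Proof.
move=> xX /(order_p_image xX)[g gG ->].
have [h hS gE] := conj_Offdiag gG.
have gS := subsetP (Gamma_sub _ _ _) _ gG.
exists (f h); first exact: mem_morphim.
rewrite -morphJ //; apply: mem_morphim; first by rewrite groupJ.
exact: (subsetP (joing_subl _ _)).
Qed.

(** A preimage g has g^2 = 1 or g^2 = -1. The first makes g central by [sqr_one], so f g = 1; the
    second is settled by [conj_weyl]. *)
Lemma involution_conj (x : rT) : x \in f @* SL R -> #[x] = 2%N ->
  exists2 y, y \in f @* SL R & x ^ y \in f @* StabSL.
Proof.
case/morphimP=> g _ gS -> o2.
have := expg_order (f g); rewrite o2 => fg2.
have : g ^+ 2 \in 'ker f by apply/kerP; rewrite ?groupX // morphX // fg2.
case/kerP2=> g2.
  have fg : f g = 1 by case: (sqr_one gS g2) => gE; rewrite gE ?f_negI ?(morph1 f).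
  by rewrite fg order1 in o2.
have [h hS gE] := conj_weyl gS g2.
exists (f h); first exact: mem_morphim.
rewrite -morphJ // gE; apply: mem_morphim; first exact: weyl_in.
exact: (subsetP (joing_subr _ _)) weyl_TorusN.
Qed.

End Construction.

Local Open Scope group_scope.

(** * Assembly of the permutation group and its normal chain *)

Theorem theorem1p3 (p k : nat) :
  mersenne_prime p -> (7 <= p)%N -> (2 <= k)%N ->
  let d := (p ^ (3 * k - 4) * (p + 1) %/ 2)%N in
  exists X : {group {perm 'I_d}},
    [transitive X, on [set: 'I_d] | 'P] /\
    elusive X /\
    exists N : {group {perm 'I_d}},
      [/\ N <| X,
          (X / N) \isog PSL2 p,
          ~~ [splits X, over N] &
          exists Nc : nat -> {group {perm 'I_d}},
            [/\ Nc 1%N = N, Nc k = 1%G,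
                (forall l, (1 <= l <= k)%N -> Nc l <| X) &
                (forall l, (1 <= l < k)%N ->
                   Nc l.+1 \subset Nc l /\ (Nc l / Nc l.+1) \isog elemC p 3)]] /\
    forall i : 'I_d,
      exists A B : {group {perm 'I_d}},
        A ><| B = 'C_X[i | 'P] /\ A \isog elemC p 2 /\ B \isog 'D_(p - 1).
Proof.
move=> [pr_p [m pM]] p7 k2 d.
have [m' mE] : exists m', m = m'.+3.
  case: m pM => [|[|[|m]]] pM; try by rewrite pM in p7.
  by exists m.
have mpos := expn_gt0 2 m'.
(* o = (p - 1)/2 = 2^(m-1) - 1 is odd, and o + 1 is a power of 2, as the degree requires. *)
pose o := (2 ^ m'.+2 - 1)%N.
have pE : p = o.*2.+1 by rewrite /o pM mE; move: mpos; rewrite !expnS /=; lia.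
have odd_o : odd o by rewrite /o; move: mpos; rewrite !expnS /=; lia.
have o3 : (2 < o)%N by lia.
have o1E : (o.+1 = 2 ^ m'.+2)%N by rewrite /o; move: mpos; rewrite !expnS /=; lia.
clearbody o.
have [red chR] := Zp_chain_ring pr_p k2.
have [z [zo prim_z]] := chain_root chR pE odd_o.
pose H := StabSL chR k2 pE odd_o o3 z.
have HS := StabSL_SL chR k2 pE odd_o o3 zo prim_z.
have HI := StabSL_index chR k2 pE odd_o o3 zo prim_z.
have [f [i0 [kf tr stab]]] := coset_representation HS HI.
rewrite (core_StabSL chR k2 pE odd_o o3 zo prim_z) in kf.
have dE : d = (p ^ (3 * k - 4) * o.+1)%N.
  rewrite /d; have -> : (p + 1 = o.+1 * 2)%N by lia.
  by rewrite mulnA mulnK.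
exists (f @* SL _)%G; split; first exact: tr.
split; first split; first exact: tr.
  move=> x xX pr_x; suff [j jx] : exists j, x j = j.
    by apply/forallPn; exists j; rewrite jx negbK.
  have conj_fix : (exists2 y, y \in f @* SL _ & x ^ y \in f @* H) -> exists j, x j = j.
    case=> y _; rewrite -stab inE => /andP[_ xy].
    exact: fixed_point_of_conj xy.
  have [ox|nxp] := eqVneq #[x] p.
    have xp : x ^+ p = 1 by rewrite -ox expg_order.
    exact: conj_fix (order_p_conj chR k2 pE odd_o o3 z kf xX xp).
  have [ox|nx2] := eqVneq #[x] 2%N.
    exact: conj_fix (involution_conj chR k2 pE odd_o o3 z kf xX ox).
  (* The degree is p^(3k-4) times a power of 2, so no other prime divides it. *)
  apply: fixed_point_coprime => //; rewrite card_ord.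
  move: #[x] pr_x nxp nx2 => r pr_r nrp nr2; rewrite dE o1E Euclid_dvdM // negb_or.
  rewrite !Euclid_dvdX // !dvdn_prime2 //.
  by rewrite (negPf nrp) (negPf nr2).
exists (f @* Gamma_group p _ 1)%G; split.
  split.
  - exact: morphim_normal (Gamma_normal _ _ _).
  - exact: (f_quotient chR pE odd_o kf).
  - exact: (f_nonsplit chR k2 pE odd_o o3 zo prim_z kf).
  exists (fun l => f @* Gamma_group p _ l)%G; split.
  - exact: erefl.
  - by apply: val_inj; rewrite /= (Gamma_k chR) morphim1.
  - by move=> l _; apply: morphim_normal (Gamma_normal _ _ _).
  move=> l lk; split; first exact/morphimS/Gamma_subS.
  exact: (f_Gamma_layer chR k2 pE odd_o o3 zo prim_z kf).
move=> i.
(* By transitivity the stabilizer of any point is a conjugate of that of [i0], and the decomposition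
   is conjugated along. *)
have [x xX ix] := atransP2 tr (in_setT i0) (in_setT i).
have stabi : 'C_(f @* SL _)[i | 'P] = (f @* H) :^ x.
  rewrite ix astab1_act -stab conjIg; congr (_ :&: _).
  exact/esym/(conjGid xX).
pose E := Offdiag_group chR k2 pE odd_o o3.
exists (f @* E :^ x)%G, (f @* TorusN z :^ x)%G; split; last split.
- by rewrite stabi -(f_sdprod chR k2 pE odd_o o3 zo prim_z f) -sdprodJ.
- exact: isog_trans (isog_symr (conj_isog (f @* E)%G x)) (f_Offdiag_isog chR k2 pE odd_o o3 zo prim_z kf).
exact: isog_trans (isog_symr (conj_isog (f @* TorusN z)%G x)) (f_TorusN_isog chR k2 pE odd_o o3 zo prim_z kf).
Qed.
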